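(* Let $A = A(0,R_1,R_2)$ with $0 \leq R_1< R_2$ and let $f : A \to \mathbb{H}$ be a regular function. There exist $\{a_n\}_{n \in \mathbb{Z}} \subseteq \mathbb{H}$ such that $$f(q) = \sum_{n \in \mathbb{Z}} q^n a_n$$ for all $q \in A$.
   Context: $\mathbb{H}$ is the skew field of real quaternions, $\mathbb{S} = \{q \in \mathbb{H} : q^2=-1\}$, $L_I = \mathbb{R} + I\mathbb{R}$ for $I\in\mathbb{S}$, $A(0,R_1,R_2)=\{q\in\mathbb{H}:R_1<|q|<R_2\}$. For a domain $\Omega\subseteq\mathbb{H}$, a real differentiable $f:\Omega\to\mathbb{H}$ is regular (Cullen-regular) if for every $I\in\mathbb{S}$ the function $\frac12\left(\frac{\partial}{\partial x}+I\frac{\partial}{\partial y}\right)f_I(x+Iy)$ vanishes identically on $\Omega_I=\Omega\cap L_I$, where $f_I=f|_{\Omega_I}$. The sum $\sum_{n\in\mathbb{Z}}q^na_n$ means $\sum_{n\ge0}q^na_n+\sum_{n>0}q^{-n}a_{-n}$, both series converging. *)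

(* Defs.v *)
From Stdlib Require Import Reals ZArith Lra.
From Coquelicot Require Import Coquelicot.
Open Scope R_scope.

(** Quaternions: [(a, b, c, d)] stands for [a + b i + c j + d k].  The real
    normed space structure is Coquelicot's on the product [R * R * R * R],
    whose norm is Euclidean. *)
Definition quat : Type := (R * R * R * R)%type.

Definition mkq (a b c d : R) : quat := (a, b, c, d).
Definition q0 (q : quat) : R := fst (fst (fst q)).
Definition q1 (q : quat) : R := snd (fst (fst q)).
Definition q2 (q : quat) : R := snd (fst q).
Definition q3 (q : quat) : R := snd q.

Definition qmult (p q : quat) : quat :=
  mkq (q0 p * q0 q - q1 p * q1 q - q2 p * q2 q - q3 p * q3 q)
      (q0 p * q1 q + q1 p * q0 q + q2 p * q3 q - q3 p * q2 q)
      (q0 p * q2 q - q1 p * q3 q + q2 p * q0 q + q3 p * q1 q)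
      (q0 p * q3 q + q1 p * q2 q - q2 p * q1 q + q3 p * q0 q).

Definition RtoQ (x : R) : quat := mkq x 0 0 0.

Definition quat_base : NormedModule R_AbsRing :=
  prod_NormedModule R_AbsRing
    (prod_NormedModule R_AbsRing
      (prod_NormedModule R_AbsRing R_NormedModule R_NormedModule)
      R_NormedModule)
    R_NormedModule.

Canonical quat_UniformSpace : UniformSpace :=
  UniformSpace.Pack quat (UniformSpace.class quat_base) quat.
Canonical quat_AbelianGroup : AbelianGroup :=
  AbelianGroup.Pack quat (AbelianGroup.class quat_base) quat.
Canonical quat_ModuleSpace : ModuleSpace R_Ring :=
  ModuleSpace.Pack R_Ring quat (ModuleSpace.class R_Ring quat_base) quat.
Canonical quat_NormedModuleAux : NormedModuleAux R_AbsRing :=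
  NormedModuleAux.Pack R_AbsRing quat
    (NormedModuleAux.class R_AbsRing quat_base) quat.
Canonical quat_NormedModule : NormedModule R_AbsRing :=
  NormedModule.Pack R_AbsRing quat (NormedModule.class R_AbsRing quat_base) quat.

Lemma quat_eq (p q : quat) :
  q0 p = q0 q -> q1 p = q1 q -> q2 p = q2 q -> q3 p = q3 q -> p = q.
Proof.
destruct p as [[[a b] c] d], q as [[[a' b'] c'] d'].
unfold q0, q1, q2, q3; simpl; intros; subst; reflexivity.
Qed.

Lemma qmult_assoc (x y z : quat) :
  qmult x (qmult y z) = qmult (qmult x y) z.
Proof.
apply quat_eq; unfold qmult, mkq, q0, q1, q2, q3; simpl; ring.
Qed.

Lemma qmult_one_r (x : quat) : qmult x (RtoQ 1) = x.
Proof.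
apply quat_eq; unfold qmult, RtoQ, mkq, q0, q1, q2, q3; simpl; ring.
Qed.

Lemma qmult_one_l (x : quat) : qmult (RtoQ 1) x = x.
Proof.
apply quat_eq; unfold qmult, RtoQ, mkq, q0, q1, q2, q3; simpl; ring.
Qed.

Lemma qmult_plus_r (x y z : quat) :
  qmult (plus x y) z = plus (qmult x z) (qmult y z).
Proof.
apply quat_eq; unfold qmult, mkq, q0, q1, q2, q3, plus; simpl;
  unfold plus; simpl; ring.
Qed.

Lemma qmult_plus_l (x y z : quat) :
  qmult x (plus y z) = plus (qmult x y) (qmult x z).
Proof.
apply quat_eq; unfold qmult, mkq, q0, q1, q2, q3, plus; simpl;
  unfold plus; simpl; ring.
Qed.

Definition quat_Ring_mixin : Ring.mixin_of quat_AbelianGroup :=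
  Ring.Mixin quat_AbelianGroup qmult (RtoQ 1)
    qmult_assoc qmult_one_r qmult_one_l qmult_plus_r qmult_plus_l.

Canonical quat_Ring : Ring :=
  Ring.Pack quat (Ring.Class quat (AbelianGroup.class quat_AbelianGroup)
                    quat_Ring_mixin) quat.

Definition qabs (q : quat) : R :=
  sqrt (q0 q ^ 2 + q1 q ^ 2 + q2 q ^ 2 + q3 q ^ 2).

Definition qconj (q : quat) : quat := mkq (q0 q) (- q1 q) (- q2 q) (- q3 q).

(** [qinv 0 = 0] *)
Definition qinv (q : quat) : quat := scal (/ (qabs q) ^ 2) (qconj q).

Lemma qabs_norm (q : quat) : norm q = qabs q.
Proof.
unfold qabs, norm; simpl; unfold prod_norm, norm; simpl.
unfold prod_norm, norm; simpl; unfold prod_norm, norm; simpl.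
unfold abs; simpl; unfold q0, q1, q2, q3.
f_equal; rewrite !Rmult_1_r, !sqrt_def;
  repeat apply Rplus_le_le_0_compat; try apply Rmult_le_pos;
  try apply Rabs_pos; try apply sqrt_pos.
rewrite <- !Rabs_mult, !(fun x => Rabs_pos_eq (x * x) (Rle_0_sqr x)); ring.
Qed.

Lemma quat_scalE (k a b c d : R) :
  scal k (mkq a b c d) = mkq (k * a) (k * b) (k * c) (k * d).
Proof. reflexivity. Qed.

Lemma qinv_r (q : quat) : q <> zero -> mult q (qinv q) = one.
Proof.
intros Hq; destruct q as [[[a b] c] d].
set (s := a ^ 2 + b ^ 2 + c ^ 2 + d ^ 2).
assert (Hs : s <> 0).
{ intros E; apply Hq; unfold s in E; simpl in E.
  apply quat_eq;
    [change (a = 0) | change (b = 0) | change (c = 0) | change (d = 0)]; nra. }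
assert (Ha : qabs (a, b, c, d) ^ 2 = s).
{ unfold qabs, q0, q1, q2, q3; simpl fst; simpl snd; fold s.
  apply pow2_sqrt; unfold s; nra. }
unfold qinv, qconj; rewrite Ha, quat_scalE; unfold q0, q1, q2, q3; simpl fst; simpl snd.
change (qmult (mkq a b c d) (mkq (/ s * a) (/ s * - b) (/ s * - c) (/ s * - d))
        = mkq 1 0 0 0).
unfold s in *.
apply quat_eq; unfold qmult, mkq, q0, q1, q2, q3; cbn [fst snd];
  field; exact Hs.
Qed.

Definition qpowz (q : quat) (n : Z) : quat :=
  match n with
  | Z0 => one
  | Zpos p => pow_n q (Pos.to_nat p)
  | Zneg p => pow_n (qinv q) (Pos.to_nat p)
  end.

(** The sphere of imaginary units. *)
Definition imag_unit (I : quat) : Prop := mult I I = opp one.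

(** The point [x + I y] of the slice [L_I]. *)
Definition slice_pt (I : quat) (x y : R) : quat :=
  plus (RtoQ x) (mult I (RtoQ y)).

(** Derivative of a curve of quaternions, coordinatewise. *)
Definition qDerive (g : R -> quat) (t : R) : quat :=
  mkq (Derive (fun s => q0 (g s)) t) (Derive (fun s => q1 (g s)) t)
      (Derive (fun s => q2 (g s)) t) (Derive (fun s => q3 (g s)) t).

(** [1/2 (d/dx + I d/dy) f_I (x + I y)] *)
Definition cullen_op (f : quat -> quat) (I : quat) (x y : R) : quat :=
  scal (1 / 2)
    (plus (qDerive (fun s => f (slice_pt I s y)) x)
          (mult I (qDerive (fun s => f (slice_pt I x s)) y))).

(** A function on an open set [Omega] is a total function whose values off
    [Omega] are irrelevant.  Real differentiability is Fréchet
    differentiability over [R]; it makes the partial derivatives in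
    [cullen_op] exist. *)
Definition regular (Omega : quat -> Prop) (f : quat -> quat) : Prop :=
  (forall q, Omega q ->
     @ex_filterdiff R_AbsRing quat_NormedModule quat_NormedModule f (locally q))
  /\
  (forall I, imag_unit I ->
   forall x y, Omega (slice_pt I x y) -> cullen_op f I x y = zero).

Definition annulus (R1 R2 : R) (q : quat) : Prop := R1 < qabs q < R2.

(** Sum over [Z]: the series over [n >= 0] and over [n < 0] both converge. *)
Definition is_Zseries (u : Z -> quat) (l : quat) : Prop :=
  exists l1 l2 : quat,
    @is_series R_AbsRing quat_NormedModule (fun n => u (Z.of_nat n)) l1 /\
    @is_series R_AbsRing quat_NormedModule
      (fun n => u (- Z.of_nat (S n))%Z) l2 /\
    l = plus l1 l2.

(* Main.v *)
Require Import Defs.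
From Stdlib Require Import Reals ZArith Lra Lia Psatz ClassicalEpsilon.
From Coquelicot Require Import Coquelicot.
Open Scope R_scope.

(** A regular function restricts to a holomorphic function on the annulus of
    each slice, if the quaternions are seen as a left vector space over that
    slice.  The expansion is therefore a statement about complex functions,
    together with a reason for the coefficients not to depend on the slice.

    Complex part.  Regularity gives real differentiability only, without
    continuous derivatives, so the starting point is Goursat's theorem, proved
    by bisection for closed real 1-forms on a rectangle
    ([closed_form_circulation]).  In logarithmic polar coordinates it says that
    the mean of a holomorphic function over the circle of radius [r] does not
    depend on [r] ([circle_mean_const]).  The Laurent coefficients are the means
    of [F(z) z^-n].  To sum the series at [w], take the difference quotient
    [h(z) = (F(z) - F(w)) / (z - w)]: it is holomorphic except at [w], where it
    is continuous, and the identity [F(z) = F(w) + (z - w) h(z)] expresses the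
    coefficients of [F] as differences of consecutive coefficients of [h], so
    that the partial sums telescope.  The remainders are coefficients of [h]
    times powers of [w]; computed on a circle outside [w] for the positive
    powers and inside [w] for the negative ones, they decay geometrically
    ([complex_laurent]).  Both halves contain the coefficient of [1/z] of [h],
    once from each side of [w]; the two values agree because the mean is
    continuous in the radius ([circle_mean_across]).

    Passage between slices.  For imaginary units [I] and [J] the quaternion
    [c = (1 - I J) / 2] satisfies [c J = I c], so multiplication by [c] on the
    left turns [J]-holomorphic functions into [I]-holomorphic ones.  Hence
    [f(x + I y)] and [c f(x + J y) + c' f(x - J y)], where [c' = (1 + I J) / 2],
    are [I]-holomorphic functions that agree on the real axis.  By the identity
    theorem ([identity_annulus]), itself a consequence of the complex Laurent
    expansion, they are equal ([representation_formula]).  The same formula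
    holds for each monomial [q^n a], so the expansion on the slice of [i]
    extends to all slices with the same coefficients. *)

(** * Goursat's theorem for closed real 1-forms on a rectangle *)

Lemma nested_intervals_point (u v : nat -> R) :
  (forall n, u n <= u (S n)) -> (forall n, v (S n) <= v n) ->
  (forall n, u n <= v n) ->
  exists p, forall n, u n <= p <= v n.
Proof.
intros Hu Hv Huv.
assert (Hu' : forall n k, u n <= u (n + k)%nat).
{ intros n; induction k as [|k IH]; [rewrite Nat.add_0_r; lra|].
  rewrite Nat.add_succ_r; generalize (Hu (n + k)%nat); lra. }
assert (Hv' : forall n k, v (n + k)%nat <= v n).
{ intros n; induction k as [|k IH]; [rewrite Nat.add_0_r; lra|].
  rewrite Nat.add_succ_r; generalize (Hv (n + k)%nat); lra. }
assert (Hx : forall n m, u n <= v m).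
{ intros n m; apply Rle_trans with (1 := Hu' n m).
  apply Rle_trans with (1 := Huv _); rewrite Nat.add_comm; apply Hv'. }
destruct (completeness (fun x => exists n, x = u n)) as [p [Hp1 Hp2]].
- exists (v 0%nat); intros x [n ->]; apply Hx.
- now exists (u 0%nat), 0%nat.
- exists p; intros n; split.
  + apply Hp1; now exists n.
  + apply Hp2; intros x [m ->]; apply Hx.
Qed.

(** Bisection in the form of an induction principle: a property that passes
    from the four quarters of a rectangle to the rectangle, and that holds for
    all small rectangles around each point, holds for the whole rectangle,
    since otherwise nested bad quarters would shrink to a point.  All
    rectangles are similar to the first one, with ratio [t], so that a bound
    proportional to [t ^ 2] is shared equally by the four quarters. *)
Lemma dyadic_rectangle_ind (L M a c : R) (Pr : R -> R -> R -> Prop) :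
  0 <= L -> 0 <= M ->
  let inside x y t :=
    0 < t /\ a <= x /\ x + L * t <= a + L /\ c <= y /\ y + M * t <= c + M in
  (forall x y t, inside x y t ->
     Pr x y (t / 2) -> Pr (x + L * (t / 2)) y (t / 2) ->
     Pr x (y + M * (t / 2)) (t / 2) ->
     Pr (x + L * (t / 2)) (y + M * (t / 2)) (t / 2) -> Pr x y t) ->
  (forall p q, a <= p <= a + L -> c <= q <= c + M ->
     exists delta, 0 < delta /\
       forall x y t, inside x y t -> t < delta ->
         x <= p <= x + L * t -> y <= q <= y + M * t -> Pr x y t) ->
  Pr a c 1.
Proof.
intros HL HM inside Hsub Hloc.
apply NNPP; intros Hbad.
pose (bad := fun s : R * R * R =>
  inside (fst (fst s)) (snd (fst s)) (snd s) /\
  ~ Pr (fst (fst s)) (snd (fst s)) (snd s)).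
assert (step : forall s : sig bad, exists s' : sig bad,
  snd (proj1_sig s') = snd (proj1_sig s) / 2 /\
  fst (fst (proj1_sig s)) <= fst (fst (proj1_sig s')) /\
  fst (fst (proj1_sig s')) + L * snd (proj1_sig s') <=
    fst (fst (proj1_sig s)) + L * snd (proj1_sig s) /\
  snd (fst (proj1_sig s)) <= snd (fst (proj1_sig s')) /\
  snd (fst (proj1_sig s')) + M * snd (proj1_sig s') <=
    snd (fst (proj1_sig s)) + M * snd (proj1_sig s)).
{ intros [[[x y] t] [Hin Hn]]; cbn [fst snd proj1_sig] in *.
  assert (HLt : 0 <= L * t) by (apply Rmult_le_pos; [|destruct Hin]; lra).
  assert (HMt : 0 <= M * t) by (apply Rmult_le_pos; [|destruct Hin]; lra).
  assert (K : exists x' y', ~ Pr x' y' (t / 2) /\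
     (x' = x \/ x' = x + L * (t / 2)) /\ (y' = y \/ y' = y + M * (t / 2))).
  { apply NNPP; intros K; apply Hn, Hsub; [exact Hin|..];
      apply NNPP; intros N; apply K; eexists _, _; (split; [exact N|]); auto. }
  destruct K as (x' & y' & Hn' & Hx' & Hy').
  assert (Hin' : bad (x', y', t / 2)).
  { split; [|exact Hn']; cbn [fst snd]; unfold inside in *.
    destruct Hx', Hy'; subst; lra. }
  exists (exist _ _ Hin'); cbn [fst snd proj1_sig].
  destruct Hx', Hy'; subst; lra. }
assert (Hb0 : bad (a, c, 1)) by (split; [unfold inside; cbn [fst snd]; lra | exact Hbad]).
pose (nxt := fun s => proj1_sig (constructive_indefinite_description _ (step s))).
pose (seq := fix seq n := match n with O => exist bad _ Hb0 | S k => nxt (seq k) end).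
pose (X := fun n => fst (fst (proj1_sig (seq n)))).
pose (Y := fun n => snd (fst (proj1_sig (seq n)))).
pose (T := fun n => snd (proj1_sig (seq n))).
assert (HS : forall n, T (S n) = T n / 2 /\ X n <= X (S n) /\
  X (S n) + L * T (S n) <= X n + L * T n /\ Y n <= Y (S n) /\
  Y (S n) + M * T (S n) <= Y n + M * T n).
{ intros n; exact (proj2_sig (constructive_indefinite_description _ (step (seq n)))). }
assert (HB : forall n, inside (X n) (Y n) (T n) /\ ~ Pr (X n) (Y n) (T n)).
{ intros n; exact (proj2_sig (seq n)). }
assert (HT : forall n, T n = (1 / 2) ^ n).
{ induction n as [|n IH]; [reflexivity|].
  destruct (HS n) as [-> _]; rewrite IH; simpl; lra. }
assert (HLT : forall n, 0 <= L * T n).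
{ intros n; apply Rmult_le_pos; [exact HL|]; destruct (HB n) as [[H _] _]; lra. }
assert (HMT : forall n, 0 <= M * T n).
{ intros n; apply Rmult_le_pos; [exact HM|]; destruct (HB n) as [[H _] _]; lra. }
destruct (nested_intervals_point X (fun n => X n + L * T n)) as [p Hp];
  [intros n; apply HS | intros n; apply HS | intros n; generalize (HLT n); lra |].
destruct (nested_intervals_point Y (fun n => Y n + M * T n)) as [q Hq];
  [intros n; apply HS | intros n; apply HS | intros n; generalize (HMT n); lra |].
destruct (Hloc p q) as (delta & Hd & Hdelta).
{ generalize (Hp 0%nat); cbn; lra. }
{ generalize (Hq 0%nat); cbn; lra. }
destruct (pow_lt_1_zero (1 / 2)) with (y := delta) as [N HN];
  [rewrite Rabs_pos_eq; lra | exact Hd |].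
destruct (HB N) as [Hin Hn]; apply Hn, Hdelta; auto.
specialize (HN N (Nat.le_refl N)); rewrite <- HT in HN.
apply Rle_lt_trans with (2 := HN), Rle_abs.
Qed.

Lemma differentiable_continuity_2d (f : R -> R -> R) (x y A B : R) :
  differentiable_pt_lim f x y A B -> continuity_2d_pt f x y.
Proof.
intros H; apply differentiable_continuity_pt; now exists A, B.
Qed.

Lemma continuity_2d_fst (f : R -> R -> R) (x y : R) :
  continuity_2d_pt f x y -> continuous (fun s => f s y) x.
Proof.
intros H; apply filterlim_locally; intros eps.
destruct (H eps) as [d Hd]; exists d; intros s Hs.
apply Hd; [exact Hs | rewrite Rminus_eq_0, Rabs_R0; apply cond_pos].
Qed.

Lemma continuity_2d_snd (f : R -> R -> R) (x y : R) :
  continuity_2d_pt f x y -> continuous (fun s => f x s) y.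
Proof.
intros H; apply filterlim_locally; intros eps.
destruct (H eps) as [d Hd]; exists d; intros s Hs.
apply Hd; [rewrite Rminus_eq_0, Rabs_R0; apply cond_pos | exact Hs].
Qed.

(** The integral of the form [P ds + Q dt] along the boundary of
    [[a, b] x [c, d]], counterclockwise. *)
Definition circulation (P Q : R -> R -> R) (a b c d : R) : R :=
  RInt (fun s => P s c) a b + RInt (fun t => Q b t) c d
  - RInt (fun s => P s d) a b - RInt (fun t => Q a t) c d.

Lemma is_RInt_affine (A B a b : R) :
  is_RInt (fun s => A + B * s) a b (A * (b - a) + B * (b ^ 2 - a ^ 2) / 2).
Proof.
replace (A * (b - a) + B * (b ^ 2 - a ^ 2) / 2)
  with (minus ((fun s => A * s + B * s ^ 2 / 2) b) ((fun s => A * s + B * s ^ 2 / 2) a)).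
2: unfold minus, plus, opp; simpl; field.
apply (is_RInt_derive (fun s => A * s + B * s ^ 2 / 2)).
- intros x _; auto_derive; [trivial | field].
- intros x _; apply (ex_derive_continuous (fun s => A + B * s)); auto_derive; trivial.
Qed.

(** Used to replace [P] and [Q] by their first-order expansions, whose
    boundary integrals are explicit. *)
Lemma RInt_near_affine (f : R -> R) (a b A B eta : R) : a <= b ->
  (forall s, a <= s <= b -> continuous f s) ->
  (forall s, a <= s <= b -> Rabs (f s - (A + B * s)) <= eta) ->
  Rabs (RInt f a b - (A * (b - a) + B * (b ^ 2 - a ^ 2) / 2)) <= eta * (b - a).
Proof.
intros Hab Hc He.
assert (Hf : is_RInt f a b (RInt f a b)).
{ apply (RInt_correct f); apply (ex_RInt_continuous f); intros z Hz.
  rewrite Rmin_left, Rmax_right in Hz by exact Hab; now apply Hc. }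
generalize (is_RInt_minus _ _ _ _ _ _ Hf (is_RInt_affine A B a b)); intros H.
apply (norm_RInt_le_const _ _ _ _ eta Hab) in H.
- rewrite (Rmult_comm eta); exact H.
- exact He.
Qed.

Lemma circulation_halves (P Q : R -> R -> R) (a b b' c d d' : R) :
  a <= b <= b' -> c <= d <= d' ->
  (forall x y, a <= x <= b' -> c <= y <= d' ->
     continuity_2d_pt P x y /\ continuity_2d_pt Q x y) ->
  circulation P Q a b' c d' =
    circulation P Q a b c d + circulation P Q b b' c d +
    circulation P Q a b d d' + circulation P Q b b' d d'.
Proof.
intros Hab Hcd H.
assert (HP : forall y u v, c <= y <= d' -> a <= u <= v -> v <= b' ->
  ex_RInt (fun s => P s y) u v).
{ intros y u v Hy Huv Hv; apply (ex_RInt_continuous (fun s => P s y)); intros z Hz.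
  rewrite Rmin_left, Rmax_right in Hz by lra.
  apply (continuity_2d_fst P); apply H; lra. }
assert (HQ : forall x u v, a <= x <= b' -> c <= u <= v -> v <= d' ->
  ex_RInt (fun s => Q x s) u v).
{ intros y u v Hy Huv Hv; apply (ex_RInt_continuous (fun s => Q y s)); intros z Hz.
  rewrite Rmin_left, Rmax_right in Hz by lra.
  apply (continuity_2d_snd Q); apply H; lra. }
unfold circulation.
rewrite <- (RInt_Chasles (fun s => P s c) a b b') by (apply HP; lra).
rewrite <- (RInt_Chasles (fun s => P s d') a b b') by (apply HP; lra).
rewrite <- (RInt_Chasles (fun s => Q b' s) c d d') by (apply HQ; lra).
rewrite <- (RInt_Chasles (fun s => Q a s) c d d') by (apply HQ; lra).
unfold plus; simpl; ring.
Qed.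

Lemma Rabs_le_sub4 (x y z w a b c d : R) :
  Rabs x <= a -> Rabs y <= b -> Rabs z <= c -> Rabs w <= d ->
  Rabs (x + y - z - w) <= a + b + c + d.
Proof.
intros; apply Rabs_le; apply Rabs_le_between in H, H0, H1, H2; lra.
Qed.

(** Only the first-order error contributes: the cross derivatives of [P] and
    [Q] are both [B], so the circulation of the affine parts cancels exactly.
    The bound is quadratic in the size of the rectangle. *)
Lemma circulation_local (P Q : R -> R -> R) (p q A B D eps : R) :
  differentiable_pt_lim P p q A B -> differentiable_pt_lim Q p q B D ->
  0 < eps ->
  exists delta, 0 < delta /\ forall a b c d,
    (forall x y, a <= x <= b -> c <= y <= d ->
       continuity_2d_pt P x y /\ continuity_2d_pt Q x y) ->
    a <= p <= b -> c <= q <= d -> b - a < delta -> d - c < delta ->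
    Rabs (circulation P Q a b c d) <= 2 * eps * ((b - a) + (d - c)) ^ 2.
Proof.
intros HP HQ Heps.
destruct (HP (mkposreal eps Heps)) as [d1 Hd1].
destruct (HQ (mkposreal eps Heps)) as [d2 Hd2]; simpl in Hd1, Hd2.
exists (Rmin d1 d2); split; [apply Rmin_pos; apply cond_pos|].
intros a b c d Hcont Hp Hq Hab Hcd.
set (eta := eps * ((b - a) + (d - c))).
assert (Hnear : forall x y, a <= x <= b -> c <= y <= d ->
  Rabs (P x y - (P p q + (A * (x - p) + B * (y - q)))) <= eta /\
  Rabs (Q x y - (Q p q + (B * (x - p) + D * (y - q)))) <= eta).
{ intros x y Hx Hy.
  assert (Rabs (x - p) <= b - a) by (apply Rabs_le; lra).
  assert (Rabs (y - q) <= d - c) by (apply Rabs_le; lra).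
  generalize (Rmin_l d1 d2) (Rmin_r d1 d2); intros.
  assert (Hm : eps * Rmax (Rabs (x - p)) (Rabs (y - q)) <= eta).
  { apply Rmult_le_compat_l; [lra|]; apply Rmax_case; lra. }
  split; (apply Rle_trans with (2 := Hm)).
  - replace (P x y - (P p q + (A * (x - p) + B * (y - q))))
      with (P x y - P p q - (A * (x - p) + B * (y - q))) by ring.
    apply Hd1; lra.
  - replace (Q x y - (Q p q + (B * (x - p) + D * (y - q))))
      with (Q x y - Q p q - (B * (x - p) + D * (y - q))) by ring.
    apply Hd2; lra. }
assert (EP : forall y, c <= y <= d -> Rabs (RInt (fun s => P s y) a b -
  ((P p q - A * p + B * (y - q)) * (b - a) + A * (b ^ 2 - a ^ 2) / 2)) <= eta * (b - a)).
{ intros y Hy; apply RInt_near_affine; [lra | |].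
  - intros s Hs; apply (continuity_2d_fst P); apply Hcont; lra.
  - intros s Hs.
    replace (P p q - A * p + B * (y - q) + A * s)
      with (P p q + (A * (s - p) + B * (y - q))) by ring.
    apply Hnear; lra. }
assert (EQ : forall x, a <= x <= b -> Rabs (RInt (fun s => Q x s) c d -
  ((Q p q - D * q + B * (x - p)) * (d - c) + D * (d ^ 2 - c ^ 2) / 2)) <= eta * (d - c)).
{ intros x Hx; apply RInt_near_affine; [lra | |].
  - intros s Hs; apply (continuity_2d_snd Q); apply Hcont; lra.
  - intros s Hs.
    replace (Q p q - D * q + B * (x - p) + D * s)
      with (Q p q + (B * (x - p) + D * (s - q))) by ring.
    apply Hnear; lra. }
replace (2 * eps * ((b - a) + (d - c)) ^ 2) with
  (eta * (b - a) + eta * (d - c) + eta * (b - a) + eta * (d - c))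
  by (unfold eta; ring).
unfold circulation.
generalize (Rabs_le_sub4 _ _ _ _ _ _ _ _ (EP c ltac:(lra)) (EQ b ltac:(lra))
  (EP d ltac:(lra)) (EQ a ltac:(lra))).
intros H; refine (Rle_trans _ _ _ (Req_le _ _ _) H); f_equal; field.
Qed.

(** Goursat's theorem for real differential forms.  The partial derivatives
    need not be continuous, which is why Green's formula is replaced by
    bisection: the bound [2 eps K^2 t^2] at scale [t] is additive under
    subdivision and holds locally, hence holds at scale [1] for every
    [eps]. *)
Theorem closed_form_circulation (P Q : R -> R -> R) (a b c d : R) :
  a <= b -> c <= d ->
  (forall x y, a <= x <= b -> c <= y <= d -> exists A B D,
     differentiable_pt_lim P x y A B /\ differentiable_pt_lim Q x y B D) ->
  circulation P Q a b c d = 0.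
Proof.
intros Hab Hcd H.
assert (Hcont : forall x y, a <= x <= b -> c <= y <= d ->
  continuity_2d_pt P x y /\ continuity_2d_pt Q x y).
{ intros x y Hx Hy; destruct (H x y Hx Hy) as (A & B & D & HP & HQ).
  split; eapply differentiable_continuity_2d; eassumption. }
set (K := (b - a) + (d - c)).
assert (HK : 0 <= K) by (unfold K; lra).
assert (Heps : forall eps, 0 < eps -> Rabs (circulation P Q a b c d) <= 2 * eps * K ^ 2).
{ intros eps Heps.
  generalize (dyadic_rectangle_ind (b - a) (d - c) a c
    (fun x y t => Rabs (circulation P Q x (x + (b - a) * t) y (y + (d - c) * t))
       <= 2 * eps * (K * t) ^ 2)); cbv zeta.
  intros Hind.
  assert (HL : 0 <= b - a) by lra. assert (HM : 0 <= d - c) by lra.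
  specialize (Hind HL HM).
  rewrite !Rmult_1_r in Hind.
  replace (a + (b - a)) with b in Hind by ring.
  replace (c + (d - c)) with d in Hind by ring.
  apply Hind; clear Hind.
  - intros x y t (Ht & Hx1 & Hx2 & Hy1 & Hy2).
    assert (HLt : 0 <= (b - a) * (t / 2)) by (apply Rmult_le_pos; lra).
    assert (HMt : 0 <= (d - c) * (t / 2)) by (apply Rmult_le_pos; lra).
    rewrite !Rplus_assoc.
    replace ((b - a) * (t / 2) + (b - a) * (t / 2)) with ((b - a) * t) by field.
    replace ((d - c) * (t / 2) + (d - c) * (t / 2)) with ((d - c) * t) by field.
    intros H1 H2 H3 H4.
    rewrite (circulation_halves P Q x (x + (b - a) * (t / 2)) _ y (y + (d - c) * (t / 2)))
      by (try lra; intros; apply Hcont; lra).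
    replace (2 * eps * (K * t) ^ 2) with
      (2 * eps * (K * (t / 2)) ^ 2 + 2 * eps * (K * (t / 2)) ^ 2 +
       2 * eps * (K * (t / 2)) ^ 2 + 2 * eps * (K * (t / 2)) ^ 2) by field.
    repeat (eapply Rle_trans; [apply Rabs_triang|]; apply Rplus_le_compat);
      assumption.
  - intros p q Hp Hq; destruct (H p q Hp Hq) as (A & B & D & HP & HQ).
    destruct (circulation_local P Q p q A B D eps HP HQ Heps) as (delta & Hd & Hdelta).
    exists (delta / (K + 1)); split; [apply Rdiv_lt_0_compat; lra|].
    intros x y t (Ht & Hx1 & Hx2 & Hy1 & Hy2) Htd Hxp Hyq.
    assert (HKt : (K + 1) * t < delta).
    { apply Rlt_div_r in Htd; [|lra]; lra. }
    assert (HLt : 0 <= (b - a) * t) by (apply Rmult_le_pos; lra).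
    assert (HMt : 0 <= (d - c) * t) by (apply Rmult_le_pos; lra).
    replace (K * t) with ((x + (b - a) * t - x) + (y + (d - c) * t - y))
      by (unfold K; ring).
    assert (K * t = (b - a) * t + (d - c) * t) by (unfold K; ring).
    apply Hdelta; try lra; intros; apply Hcont; lra. }
destruct (Req_dec (circulation P Q a b c d) 0) as [E|E]; [exact E|exfalso].
apply Rabs_pos_lt in E.
set (X := Rabs (circulation P Q a b c d)) in *.
assert (HK2 : 0 <= K ^ 2) by apply pow2_ge_0.
specialize (Heps (X / (4 * (K ^ 2 + 1)))).
assert (Y : 0 < X / (4 * (K ^ 2 + 1))) by (apply Rdiv_lt_0_compat; lra).
specialize (Heps Y).
assert (Z : X / (4 * (K ^ 2 + 1)) * (4 * (K ^ 2 + 1)) = X) by (field; lra).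
nra.
Qed.

(** * Continuity and differentiability of complex functions *)

Definition ccont (F : C -> C) (z : C) : Prop :=
  forall eps, 0 < eps -> exists delta, 0 < delta /\
    forall w, Cmod (w - z) < delta -> Cmod (F w - F z) < eps.

(** Complex differentiability in Caratheodory's form: the difference quotient
    [phi] extends continuously to [z].  With the quotient as a function,
    products and inverses need no estimates, and the value [phi z] fills the
    removable singularity of the quotient. *)
Definition cdiff (F : C -> C) (z : C) : Prop :=
  exists phi, ccont phi z /\ exists delta, 0 < delta /\
    forall w, Cmod (w - z) < delta -> F w = (F z + phi w * (w - z))%C.

Lemma Cmod_self_minus (z : C) : Cmod (z - z) = 0.
Proof. replace (z - z)%C with (RtoC 0) by ring; apply Cmod_0. Qed.

Lemma ccont_ext_loc (F G : C -> C) (z : C) (delta : R) :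
  0 < delta -> (forall w, Cmod (w - z) < delta -> F w = G w) ->
  ccont F z -> ccont G z.
Proof.
intros Hd He HF eps Heps; destruct (HF eps Heps) as (d & Hd' & H).
exists (Rmin delta d); split; [now apply Rmin_pos|]; intros w Hw.
assert (Cmod (w - z) < delta) by (eapply Rlt_le_trans; [exact Hw | apply Rmin_l]).
assert (Cmod (w - z) < d) by (eapply Rlt_le_trans; [exact Hw | apply Rmin_r]).
rewrite <- !He; auto. rewrite Cmod_self_minus; exact Hd.
Qed.

Lemma ccont_const (c z : C) : ccont (fun _ => c) z.
Proof.
intros eps Heps; exists 1; split; [lra|]; intros w _; now rewrite Cmod_self_minus.
Qed.

Lemma ccont_id (z : C) : ccont (fun w => w) z.
Proof. intros eps Heps; exists eps; split; auto. Qed.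

Lemma ccont_plus (F G : C -> C) (z : C) :
  ccont F z -> ccont G z -> ccont (fun w => F w + G w)%C z.
Proof.
intros HF HG eps Heps.
destruct (HF (eps / 2)) as (d1 & Hd1 & H1); [lra|].
destruct (HG (eps / 2)) as (d2 & Hd2 & H2); [lra|].
exists (Rmin d1 d2); split; [now apply Rmin_pos|]; intros w Hw.
assert (Hw1 : Cmod (w - z) < d1) by (eapply Rlt_le_trans; [exact Hw | apply Rmin_l]).
assert (Hw2 : Cmod (w - z) < d2) by (eapply Rlt_le_trans; [exact Hw | apply Rmin_r]).
replace (F w + G w - (F z + G z))%C with ((F w - F z) + (G w - G z))%C by ring.
generalize (H1 w Hw1) (H2 w Hw2) (Cmod_triangle (F w - F z) (G w - G z)); lra.
Qed.

Lemma ccont_mult (F G : C -> C) (z : C) :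
  ccont F z -> ccont G z -> ccont (fun w => F w * G w)%C z.
Proof.
intros HF HG eps Heps.
set (K := Cmod (F z) + Cmod (G z) + 1).
assert (HK : 1 <= K) by (unfold K; generalize (Cmod_ge_0 (F z)) (Cmod_ge_0 (G z)); lra).
set (e := Rmin 1 (eps / (2 * K))).
assert (HeK : eps / (2 * K) * K = eps / 2) by (field; lra).
assert (He : 0 < e).
{ apply Rmin_pos; [lra|]; apply Rdiv_lt_0_compat; lra. }
assert (He1 : e <= 1) by apply Rmin_l.
assert (He2 : e <= eps / (2 * K)) by apply Rmin_r.
destruct (HF e He) as (d1 & Hd1 & H1).
destruct (HG e He) as (d2 & Hd2 & H2).
exists (Rmin d1 d2); split; [now apply Rmin_pos|]; intros w Hw.
assert (Hw1 : Cmod (w - z) < d1) by (eapply Rlt_le_trans; [exact Hw | apply Rmin_l]).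
assert (Hw2 : Cmod (w - z) < d2) by (eapply Rlt_le_trans; [exact Hw | apply Rmin_r]).
replace (F w * G w - F z * G z)%C with
  ((F w - F z) * G z + (G w - G z) * F z + (F w - F z) * (G w - G z))%C by ring.
eapply Rle_lt_trans; [apply Cmod_triangle|].
eapply Rle_lt_trans; [apply Rplus_le_compat_r, Cmod_triangle|].
rewrite !Cmod_mult.
specialize (H1 w Hw1); specialize (H2 w Hw2).
generalize (Cmod_ge_0 (F z)) (Cmod_ge_0 (G z)) (Cmod_ge_0 (F w - F z))
  (Cmod_ge_0 (G w - G z)); unfold K in *.
set (a := Cmod (F z)) in *; set (b := Cmod (G z)) in *.
set (x := Cmod (F w - F z)) in *; set (y := Cmod (G w - G z)) in *; intros.
assert (x * b <= e * b) by nra. assert (y * a <= e * a) by nra.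
assert (x * y <= e) by nra.
assert (e * (a + b + 1) <= eps / (2 * (a + b + 1)) * (a + b + 1)) by nra.
lra.
Qed.

Lemma ccont_opp (F : C -> C) (z : C) : ccont F z -> ccont (fun w => - F w)%C z.
Proof.
intros HF eps Heps; destruct (HF eps Heps) as (d & Hd & H); exists d; split; auto.
intros w Hw; replace (- F w - - F z)%C with (- (F w - F z))%C by ring.
rewrite Cmod_opp; auto.
Qed.

Lemma ccont_minus (F G : C -> C) (z : C) :
  ccont F z -> ccont G z -> ccont (fun w => F w - G w)%C z.
Proof. intros HF HG; apply ccont_plus; [exact HF | now apply ccont_opp]. Qed.

Lemma ccont_neq0 (F : C -> C) (z : C) : ccont F z -> F z <> 0 ->
  exists delta, 0 < delta /\
    forall w, Cmod (w - z) < delta -> Cmod (F z) / 2 < Cmod (F w).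
Proof.
intros HF Hz; apply Cmod_gt_0 in Hz.
destruct (HF (Cmod (F z) / 2)) as (d & Hd & H); [lra|].
exists d; split; [exact Hd|]; intros w Hw; specialize (H w Hw).
generalize (Cmod_triangle (F w) (- (F w - F z))); rewrite Cmod_opp.
replace (F w + - (F w - F z))%C with (F z) by ring; lra.
Qed.

Lemma ccont_inv (F : C -> C) (z : C) : ccont F z -> F z <> 0 ->
  ccont (fun w => / F w)%C z.
Proof.
intros HF Hz eps Heps.
destruct (ccont_neq0 F z HF Hz) as (d1 & Hd1 & H1).
assert (Hp := proj1 (Cmod_gt_0 _) Hz); set (m := Cmod (F z)) in *.
destruct (HF (eps * (m / 2 * m))) as (d2 & Hd2 & H2); [repeat apply Rmult_lt_0_compat; lra|].
exists (Rmin d1 d2); split; [now apply Rmin_pos|]; intros w Hw.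
assert (Hw1 : Cmod (w - z) < d1) by (eapply Rlt_le_trans; [exact Hw | apply Rmin_l]).
assert (Hw2 : Cmod (w - z) < d2) by (eapply Rlt_le_trans; [exact Hw | apply Rmin_r]).
specialize (H1 w Hw1); specialize (H2 w Hw2).
assert (Hnz : F w <> 0) by (apply Cmod_gt_0; lra).
replace (/ F w - / F z)%C with (- (F w - F z) / (F w * F z))%C by (field; auto).
rewrite Cmod_div, Cmod_opp, Cmod_mult by now apply Cmult_neq_0.
fold m; apply Rlt_div_l; [apply Rmult_lt_0_compat; lra|].
apply Rlt_le_trans with (1 := H2); apply Rmult_le_compat_l; [lra|].
apply Rmult_le_compat_r; lra.
Qed.

Lemma ccont_pow (F : C -> C) (z : C) (n : nat) :
  ccont F z -> ccont (fun w => F w ^ n)%C z.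
Proof.
intros HF; induction n as [|n IH]; [exact (ccont_const 1 z)|].
exact (ccont_mult _ _ z HF IH).
Qed.

Lemma cdiff_ccont (F : C -> C) (z : C) : cdiff F z -> ccont F z.
Proof.
intros (phi & Hphi & d & Hd & H).
apply (ccont_ext_loc (fun w => F z + phi w * (w - z))%C _ _ d Hd).
- intros w Hw; now rewrite <- H.
- apply ccont_plus; [apply ccont_const|]; apply ccont_mult; [exact Hphi|].
  apply ccont_minus; [apply ccont_id | apply ccont_const].
Qed.

Lemma cdiff_const (c z : C) : cdiff (fun _ => c) z.
Proof.
exists (fun _ => 0); split; [apply ccont_const|].
exists 1; split; [lra|]; intros; ring.
Qed.

Lemma cdiff_id (z : C) : cdiff (fun w => w) z.
Proof.
exists (fun _ => 1); split; [apply ccont_const|].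
exists 1; split; [lra|]; intros; ring.
Qed.

Lemma cdiff_minus (F G : C -> C) (z : C) :
  cdiff F z -> cdiff G z -> cdiff (fun w => F w - G w)%C z.
Proof.
intros (f & Hf & d1 & Hd1 & H1) (g & Hg & d2 & Hd2 & H2).
exists (fun w => f w - g w)%C; split; [now apply ccont_minus|].
exists (Rmin d1 d2); split; [now apply Rmin_pos|]; intros w Hw.
rewrite H1, H2; [ring| |]; (eapply Rlt_le_trans; [exact Hw|]);
  [apply Rmin_r | apply Rmin_l].
Qed.

Lemma cdiff_mult (F G : C -> C) (z : C) :
  cdiff F z -> cdiff G z -> cdiff (fun w => F w * G w)%C z.
Proof.
intros HF HG; assert (HF' := cdiff_ccont _ _ HF).
destruct HF as (f & Hf & d1 & Hd1 & H1), HG as (g & Hg & d2 & Hd2 & H2).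
exists (fun w => f w * G z + F w * g w)%C; split.
{ apply ccont_plus; apply ccont_mult; auto using ccont_const. }
exists (Rmin d1 d2); split; [now apply Rmin_pos|]; intros w Hw.
rewrite H1, H2; [ring| |]; (eapply Rlt_le_trans; [exact Hw|]);
  [apply Rmin_r | apply Rmin_l].
Qed.

Lemma cdiff_pow (F : C -> C) (z : C) (n : nat) :
  cdiff F z -> cdiff (fun w => F w ^ n)%C z.
Proof.
intros HF; induction n as [|n IH]; [exact (cdiff_const 1 z)|].
exact (cdiff_mult _ _ z HF IH).
Qed.

Lemma cdiff_inv (F : C -> C) (z : C) :
  cdiff F z -> F z <> 0 -> cdiff (fun w => / F w)%C z.
Proof.
intros HF Hz; assert (HF' := cdiff_ccont _ _ HF).
destruct (ccont_neq0 F z HF' Hz) as (d1 & Hd1 & H1).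
destruct HF as (f & Hf & d2 & Hd2 & H2).
assert (Hp := proj1 (Cmod_gt_0 _) Hz).
exists (fun w => - f w * (/ F w * / F z))%C; split.
{ apply ccont_mult; [now apply ccont_opp|]; apply ccont_mult;
    [now apply ccont_inv | apply ccont_const]. }
exists (Rmin d1 d2); split; [now apply Rmin_pos|]; intros w Hw.
assert (Hw1 : Cmod (w - z) < d1) by (eapply Rlt_le_trans; [exact Hw | apply Rmin_l]).
assert (Hw2 : Cmod (w - z) < d2) by (eapply Rlt_le_trans; [exact Hw | apply Rmin_r]).
specialize (H1 w Hw1).
assert (Hnz : F w <> 0) by (apply Cmod_gt_0; lra).
assert (E : (f w * (w - z) = F w - F z)%C) by (rewrite (H2 w Hw2); ring).
replace (- f w * (/ F w * / F z) * (w - z))%C with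
  (- (f w * (w - z)) * (/ F w * / F z))%C by ring.
rewrite E; field; auto.
Qed.

Lemma cdiff_shift (F : C -> C) (c z : C) :
  cdiff F (c + z)%C -> cdiff (fun w => F (c + w)%C) z.
Proof.
assert (E : forall w, (c + w - (c + z) = w - z)%C) by (intros; ring).
intros (f & Hf & d & Hd & H); exists (fun w => f (c + w)%C); split.
- intros eps Heps; destruct (Hf eps Heps) as (d' & Hd' & H'); exists d'; split; auto.
  intros w Hw; apply H'; now rewrite E.
- exists d; split; auto; intros w Hw; rewrite H by now rewrite E.
  now rewrite E.
Qed.

(** * Means over circles centred at the origin *)

Definition cis (t : R) : C := (cos t, sin t).

Definition circle_mean (H : C -> C) (r : R) : C :=
  (RInt (fun t => Re (H (r * cis t)%C)) 0 (2 * PI) / (2 * PI),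
   RInt (fun t => Im (H (r * cis t)%C)) 0 (2 * PI) / (2 * PI)).

Lemma Cmod_cis (t : R) : Cmod (cis t) = 1.
Proof.
unfold Cmod, cis; simpl.
replace (cos t * (cos t * 1) + sin t * (sin t * 1)) with (Rsqr (sin t) + Rsqr (cos t))
  by (unfold Rsqr; ring).
rewrite sin2_cos2; apply sqrt_1.
Qed.

Lemma Cmod_circle (r t : R) : 0 <= r -> Cmod (r * cis t) = r.
Proof. intros Hr; rewrite Cmod_mult, Cmod_cis, Cmod_R, Rabs_pos_eq; lra. Qed.

Lemma Rabs_Im_le (z : C) : Rabs (Im z) <= Cmod z.
Proof. eapply Rle_trans; [|apply Rmax_Cmod]; apply Rmax_r. Qed.

Lemma Cmod_le_sum (z : C) : Cmod z <= Rabs (Re z) + Rabs (Im z).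
Proof.
replace z with (RtoC (Re z) + Ci * RtoC (Im z))%C at 1.
- eapply Rle_trans; [apply Cmod_triangle|].
  rewrite Cmod_mult, Cmod_Ci, !Cmod_R; lra.
- destruct z; unfold Ci, RtoC, Cplus, Cmult, Re, Im; simpl; f_equal; ring.
Qed.

(** Complex differentiability gives the Cauchy-Riemann equations, at one
    point. *)
Lemma cdiff_differentiable (H : C -> C) (x y : R) :
  cdiff H (x, y) -> exists p q : R,
    differentiable_pt_lim (fun u v => Re (H (u, v))) x y p (- q) /\
    differentiable_pt_lim (fun u v => Im (H (u, v))) x y q p.
Proof.
intros (phi & Hphi & d & Hd & HH).
set (D := phi (x, y)); exists (Re D), (Im D).
assert (K : forall eps : posreal, locally_2d (fun u v =>
  Cmod (H (u, v) - H (x, y) - D * ((u, v) - (x, y)))%C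
    <= eps * Rmax (Rabs (u - x)) (Rabs (v - y))) x y).
{ intros eps.
  destruct (Hphi (eps / 2)) as (d' & Hd' & Hc); [generalize (cond_pos eps); lra|].
  assert (Hm : 0 < Rmin d d' / 2) by (generalize (Rmin_pos _ _ Hd Hd'); lra).
  exists (mkposreal _ Hm); simpl; intros u v Hu Hv.
  assert (Hle : Cmod ((u, v) - (x, y))%C <= Rabs (u - x) + Rabs (v - y)).
  { apply (Cmod_le_sum ((u, v) - (x, y))%C). }
  generalize (Rmin_l d d') (Rmin_r d d'); intros Hl Hr.
  rewrite HH by lra.
  replace (H (x, y) + phi (u, v) * ((u, v) - (x, y)) - H (x, y) - D * ((u, v) - (x, y)))%C
    with ((phi (u, v) - D) * ((u, v) - (x, y)))%C by ring.
  rewrite Cmod_mult.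
  specialize (Hc (u, v) ltac:(lra)); fold D in Hc.
  generalize (Rmax_l (Rabs (u - x)) (Rabs (v - y))) (Rmax_r (Rabs (u - x)) (Rabs (v - y))).
  generalize (Cmod_ge_0 (phi (u, v) - D)) (Cmod_ge_0 ((u, v) - (x, y))); intros.
  apply Rle_trans with (eps / 2 * (2 * Rmax (Rabs (u - x)) (Rabs (v - y)))); [|lra].
  apply Rmult_le_compat; lra. }
split; intros eps; destruct (K eps) as [d' Hd']; exists d'; intros u v Hu Hv;
  specialize (Hd' u v Hu Hv); refine (Rle_trans _ _ _ _ Hd').
- refine (Rle_trans _ _ _ _ (re_le_Cmod _)); apply Req_le; f_equal.
  unfold Re, Im, Cminus, Cmult, Copp, Cplus; simpl; ring.
- refine (Rle_trans _ _ _ _ (Rabs_Im_le _)); apply Req_le; f_equal.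
  unfold Re, Im, Cminus, Cmult, Copp, Cplus; simpl; ring.
Qed.

Lemma differentiable_polar (s t : R) :
  differentiable_pt_lim (fun s t => exp s * cos t) s t (exp s * cos t) (- (exp s * sin t)) /\
  differentiable_pt_lim (fun s t => exp s * sin t) s t (exp s * sin t) (exp s * cos t).
Proof.
assert (M : forall x y, differentiable_pt_lim Rmult x y y x).
{ intros x y eps; exists eps; intros u v Hu Hv.
  replace (u * v - x * y - (y * (u - x) + x * (v - y))) with ((u - x) * (v - y)) by ring.
  rewrite Rabs_mult; apply Rmult_le_compat; try apply Rabs_pos; [lra | apply Rmax_r]. }
assert (E : differentiable_pt_lim (fun u _ => exp u) s t (exp s) 0).
{ apply differentiable_pt_lim_proj1_0, derivable_pt_lim_exp. }
assert (S : forall f l, derivable_pt_lim f t l -> differentiable_pt_lim (fun _ v => f v) s t 0 l).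
{ intros f l Hf eps; destruct (differentiable_pt_lim_proj1_0 f t s l Hf eps) as [d Hd].
  exists d; intros u v Hu Hv; specialize (Hd v u Hv Hu).
  rewrite Rmax_comm; replace (0 * (u - s) + l * (v - t)) with (l * (v - t) + 0 * (u - s)) by ring.
  exact Hd. }
split.
- replace (- (exp s * sin t)) with (cos t * 0 + exp s * - sin t) by ring.
  replace (exp s * cos t) with (cos t * exp s + exp s * 0) by ring.
  apply (differentiable_pt_lim_comp Rmult (fun u _ => exp u) (fun _ v => cos v));
    [apply M | exact E | apply S, derivable_pt_lim_cos].
- replace (differentiable_pt_lim (fun s t => exp s * sin t) s t (exp s * sin t) (exp s * cos t))
    with (differentiable_pt_lim (fun s t => exp s * sin t) s t
      (sin t * exp s + exp s * 0) (sin t * 0 + exp s * cos t)) by (f_equal; ring).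
  apply (differentiable_pt_lim_comp Rmult (fun u _ => exp u) (fun _ v => sin v));
    [apply M | exact E | apply S, derivable_pt_lim_sin].
Qed.

Lemma polar_eq (s t : R) : (exp s * cis t)%C = (exp s * cos t, exp s * sin t).
Proof. unfold cis, RtoC, Cmult; simpl; f_equal; ring. Qed.

(** In the logarithmic polar coordinates [z = exp s * cis t], the form
    [H(z) (ds + i dt)] is closed when [H] is holomorphic; [P ds + Q dt] is its
    imaginary part.  Around [[ln r1, ln r2] x [0, 2 PI]] the two horizontal
    sides cancel by periodicity, and the vertical sides are the two circle
    integrals. *)
Lemma circle_integral_Re_const (H : C -> C) (r1 r2 : R) :
  0 < r1 <= r2 -> (forall z, r1 <= Cmod z <= r2 -> cdiff H z) ->
  RInt (fun t => Re (H (r1 * cis t)%C)) 0 (2 * PI) =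
  RInt (fun t => Re (H (r2 * cis t)%C)) 0 (2 * PI).
Proof.
intros [Hr1 Hr2] HH.
pose (P := fun s t => Im (H (exp s * cis t)%C)).
pose (Q := fun s t => Re (H (exp s * cis t)%C)).
assert (HP : circulation P Q (ln r1) (ln r2) 0 (2 * PI) = 0).
{ apply closed_form_circulation.
  - destruct Hr2 as [Hr2|<-]; [|lra]; left; apply ln_increasing; lra.
  - generalize PI_RGT_0; lra.
  - intros s t Hs _.
    destruct (cdiff_differentiable H (exp s * cos t) (exp s * sin t)) as (p & q & HR & HI).
    { rewrite <- polar_eq; apply HH; rewrite Cmod_circle by (left; apply exp_pos).
      rewrite <- (exp_ln r1), <- (exp_ln r2) by lra.
      split; [destruct Hs as [[Hs|<-] _] | destruct Hs as [_ [Hs| ->]]]; try lra;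
        left; now apply exp_increasing. }
    destruct (differentiable_polar s t) as [Hx Hy].
    generalize (differentiable_pt_lim_comp _ _ _ _ _ _ _ _ _ _ _ HR Hx Hy).
    generalize (differentiable_pt_lim_comp _ _ _ _ _ _ _ _ _ _ _ HI Hx Hy).
    intros HI' HR'.
    eexists _, _, _; split.
    + eapply differentiable_pt_lim_ext; [|exact HI'].
      apply locally_2d_forall; intros u v; unfold P; now rewrite polar_eq.
    + match type of HI' with differentiable_pt_lim _ _ _ _ ?b =>
        match type of HR' with differentiable_pt_lim _ _ _ ?a _ =>
          replace b with a by ring end end.
      eapply differentiable_pt_lim_ext; [|exact HR'].
      apply locally_2d_forall; intros u v; unfold Q; now rewrite polar_eq. }
unfold circulation, P, Q in HP.
assert (E : cis (2 * PI) = cis 0) by (unfold cis; now rewrite cos_2PI, sin_2PI, cos_0, sin_0).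
rewrite E, !exp_ln in HP by lra; lra.
Qed.

(** The imaginary part of [H] is the real part of [-i H], so both parts of the
    mean come from the previous lemma. *)
Lemma circle_mean_const (H : C -> C) (r1 r2 : R) :
  0 < r1 -> 0 < r2 ->
  (forall z, Rmin r1 r2 <= Cmod z <= Rmax r1 r2 -> cdiff H z) ->
  circle_mean H r1 = circle_mean H r2.
Proof.
revert r1 r2.
assert (K : forall r1 r2, 0 < r1 <= r2 ->
  (forall z, r1 <= Cmod z <= r2 -> cdiff H z) -> circle_mean H r1 = circle_mean H r2).
{ intros r1 r2 Hr HH; unfold circle_mean; f_equal; f_equal.
  - now apply circle_integral_Re_const.
  - assert (E : forall t, Im (H t) = Re (- Ci * H t)%C).
    { intros t; unfold Re, Im, Ci, Cmult, Copp; simpl; ring. }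
    assert (E' : forall r, RInt (fun t => Im (H (RtoC r * cis t)%C)) 0 (2 * PI) =
      RInt (fun t => Re (- Ci * H (RtoC r * cis t)%C)%C) 0 (2 * PI)).
    { intros r; apply RInt_ext; intros; apply E. }
    rewrite !E'.
    apply (circle_integral_Re_const (fun z => - Ci * H z)%C); [exact Hr|].
    intros z Hz; apply cdiff_mult; [apply cdiff_const | now apply HH]. }
intros r1 r2 H1 H2 HH; destruct (Rle_dec r1 r2) as [L|L].
- rewrite Rmin_left, Rmax_right in HH by lra; apply K; [lra | exact HH].
- rewrite Rmin_right, Rmax_left in HH by lra; symmetry; apply K; [lra | exact HH].
Qed.

Lemma circle_dist (r r' t t' : R) : 0 <= r ->
  Cmod (r' * cis t' - r * cis t) <=
    Rabs (r' - r) + r * (Rabs (cos t' - cos t) + Rabs (sin t' - sin t)).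
Proof.
intros Hr.
replace (r' * cis t' - r * cis t)%C
  with ((r' - r)%R * cis t' + r * (cis t' - cis t))%C by (rewrite RtoC_minus; ring).
eapply Rle_trans; [apply Cmod_triangle|].
rewrite !Cmod_mult, Cmod_cis, !Cmod_R, Rmult_1_r, (Rabs_pos_eq r) by exact Hr.
apply Rplus_le_compat_l, Rmult_le_compat_l; [exact Hr|].
apply (Cmod_le_sum (cis t' - cis t)).
Qed.

Lemma circle_continuity_2d (H : C -> C) (r t : R) : 0 <= r ->
  ccont H (r * cis t)%C ->
  continuity_2d_pt (fun r t => Re (H (r * cis t)%C)) r t /\
  continuity_2d_pt (fun r t => Im (H (r * cis t)%C)) r t.
Proof.
intros Hr HH.
assert (K : forall eps : posreal, locally_2d (fun r' t' =>
  Cmod (H (r' * cis t')%C - H (r * cis t)%C) < eps) r t).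
{ intros eps; destruct (HH eps (cond_pos eps)) as (d & Hd & Hc).
  assert (He : 0 < d / (2 * (2 * r + 1))) by (apply Rdiv_lt_0_compat; lra).
  destruct (proj1 (filterlim_locally _ _) (continuous_cos t) (mkposreal _ He)) as [d1 H1].
  destruct (proj1 (filterlim_locally _ _) (continuous_sin t) (mkposreal _ He)) as [d2 H2].
  assert (Hm : 0 < Rmin (d / 2) (Rmin d1 d2)).
  { repeat apply Rmin_pos; try apply cond_pos; lra. }
  exists (mkposreal _ Hm); simpl; intros r' t' Hr' Ht'.
  apply Hc; eapply Rle_lt_trans; [apply circle_dist; exact Hr|].
  assert (Hr1 : Rabs (r' - r) < d / 2) by (eapply Rlt_le_trans; [exact Hr' | apply Rmin_l]).
  assert (T1 : Rabs (t' - t) < d1).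
  { eapply Rlt_le_trans; [exact Ht'|]; eapply Rle_trans; [apply Rmin_r | apply Rmin_l]. }
  assert (T2 : Rabs (t' - t) < d2).
  { eapply Rlt_le_trans; [exact Ht'|]; eapply Rle_trans; [apply Rmin_r | apply Rmin_r]. }
  specialize (H1 t' T1); specialize (H2 t' T2).
  change (Rabs (cos t' - cos t) < d / (2 * (2 * r + 1))) in H1.
  change (Rabs (sin t' - sin t) < d / (2 * (2 * r + 1))) in H2.
  assert (E : (2 * r + 1) * (d / (2 * (2 * r + 1))) = d / 2) by (field; lra).
  nra. }
split; intros eps; destruct (K eps) as [d Hd]; exists d; intros u v Hu Hv;
  refine (Rle_lt_trans _ _ _ _ (Hd u v Hu Hv)).
- refine (Rle_trans _ _ _ _ (re_le_Cmod _)); now right.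
- refine (Rle_trans _ _ _ _ (Rabs_Im_le _)); now right.
Qed.

Definition circle_cont (H : C -> C) (r : R) : Prop :=
  0 <= r /\ forall z, Cmod z = r -> ccont H z.

Lemma circle_ex_RInt (H : C -> C) (r : R) : circle_cont H r ->
  ex_RInt (fun t => Re (H (r * cis t)%C)) 0 (2 * PI) /\
  ex_RInt (fun t => Im (H (r * cis t)%C)) 0 (2 * PI).
Proof.
intros [Hr HH]; split;
  [apply (ex_RInt_continuous (fun t => Re (H (r * cis t)%C))) |
   apply (ex_RInt_continuous (fun t => Im (H (r * cis t)%C)))]; intros t _;
  [apply (continuity_2d_snd (fun r t => Re (H (r * cis t)%C))) |
   apply (continuity_2d_snd (fun r t => Im (H (r * cis t)%C)))];
  apply circle_continuity_2d; auto; apply HH; now apply Cmod_circle.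
Qed.

Lemma circle_mean_ext (F G : C -> C) (r : R) : 0 <= r ->
  (forall z, Cmod z = r -> F z = G z) -> circle_mean F r = circle_mean G r.
Proof.
intros Hr HFG; unfold circle_mean; f_equal; f_equal; apply RInt_ext; intros t _;
  now rewrite HFG by now apply Cmod_circle.
Qed.

Lemma RInt_linear2 (f g : R -> R) (a b p q : R) : ex_RInt f p q -> ex_RInt g p q ->
  RInt (fun t => a * f t + b * g t) p q = a * RInt f p q + b * RInt g p q.
Proof.
intros Hf Hg; apply is_RInt_unique.
apply (is_RInt_plus (V := R_NormedModule) (fun t => a * f t) (fun t => b * g t));
  [apply (is_RInt_scal (V := R_NormedModule) f) | apply (is_RInt_scal (V := R_NormedModule) g)];
  now apply (@RInt_correct R_CompleteNormedModule).
Qed.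

Lemma circle_mean_minus (F G : C -> C) (r : R) : circle_cont F r -> circle_cont G r ->
  circle_mean (fun z => F z - G z)%C r = (circle_mean F r - circle_mean G r)%C.
Proof.
intros HF HG; apply circle_ex_RInt in HF, HG; destruct HF as [F1 F2], HG as [G1 G2].
assert (Hpi := PI_RGT_0).
unfold circle_mean, Cminus, Copp, Cplus; cbn [fst snd]; f_equal.
- rewrite (RInt_ext _ (fun t => 1 * Re (F (r * cis t)%C) + -1 * Re (G (r * cis t)%C)))
    by (intros; unfold Re; simpl; ring).
  rewrite RInt_linear2 by assumption; field; lra.
- rewrite (RInt_ext _ (fun t => 1 * Im (F (r * cis t)%C) + -1 * Im (G (r * cis t)%C)))
    by (intros; unfold Im; simpl; ring).
  rewrite RInt_linear2 by assumption; field; lra.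
Qed.

Lemma circle_mean_scal (c : C) (F : C -> C) (r : R) : circle_cont F r ->
  circle_mean (fun z => c * F z)%C r = (c * circle_mean F r)%C.
Proof.
intros HF; apply circle_ex_RInt in HF; destruct HF as [F1 F2].
assert (Hpi := PI_RGT_0).
unfold circle_mean, Cmult; cbn [fst snd]; f_equal.
- rewrite (RInt_ext _ (fun t => Re c * Re (F (r * cis t)%C) + - Im c * Im (F (r * cis t)%C)))
    by (intros; unfold Re, Im, Cmult; simpl; ring).
  rewrite RInt_linear2 by assumption; unfold Re, Im, Cmult; field; lra.
- rewrite (RInt_ext _ (fun t => Re c * Im (F (r * cis t)%C) + Im c * Re (F (r * cis t)%C)))
    by (intros; unfold Re, Im, Cmult; simpl; ring).
  rewrite RInt_linear2 by assumption; unfold Re, Im, Cmult; field; lra.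
Qed.

Lemma circle_mean_bound (H : C -> C) (r B : R) : circle_cont H r ->
  (forall t, 0 <= t <= 2 * PI -> Cmod (H (r * cis t)%C) <= B) ->
  Cmod (circle_mean H r) <= 2 * B.
Proof.
intros HH HB; destruct (circle_ex_RInt H r HH) as [H1 H2]; destruct HH as [Hr _].
assert (Hpi := PI_RGT_0).
assert (K : forall g, ex_RInt g 0 (2 * PI) ->
  (forall t, 0 <= t <= 2 * PI -> Rabs (g t) <= B) ->
  Rabs (RInt g 0 (2 * PI) / (2 * PI)) <= B).
{ intros g Hg Hb; apply (@RInt_correct R_CompleteNormedModule) in Hg.
  apply (norm_RInt_le_const g 0 (2 * PI) _ B) in Hg; [|lra | intros; now apply Hb].
  change (Rabs (RInt g 0 (2 * PI)) <= (2 * PI - 0) * B) in Hg.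
  unfold Rdiv; rewrite Rabs_mult, (Rabs_pos_eq (/ (2 * PI)))
    by (left; apply Rinv_0_lt_compat; lra).
  apply Rle_div_l; lra. }
eapply Rle_trans; [apply Cmod_le_sum|].
replace (2 * B) with (B + B) by ring; apply Rplus_le_compat; apply K; auto; intros t Ht;
  (eapply Rle_trans; [|apply (HB t Ht)]); [apply re_le_Cmod | apply Rabs_Im_le].
Qed.

Lemma circle_cont_mult (F G : C -> C) (r : R) :
  circle_cont F r -> circle_cont G r -> circle_cont (fun z => F z * G z)%C r.
Proof.
intros [Hr HF] [_ HG]; split; [exact Hr|]; intros z Hz; apply ccont_mult; auto.
Qed.

(** One constant [B] serves for all weights [g]: with [g] a power of [z] or
    [/ z] this is the Cauchy estimate. *)
Lemma circle_mean_weight_bound (H : C -> C) (r : R) : circle_cont H r ->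
  exists B, 0 <= B /\ forall (g : C -> C) (rho : R), circle_cont g r ->
    (forall z, Cmod z = r -> Cmod (g z) <= rho) ->
    Cmod (circle_mean (fun z => H z * g z)%C r) <= B * rho.
Proof.
intros HH; assert (HH' := HH); destruct HH' as [Hr HC].
destruct (bounded_continuity (fun t => Re (H (r * cis t)%C)) 0 (2 * PI)) as [M1 H1].
{ intros t _; apply (continuity_2d_snd (fun r t => Re (H (r * cis t)%C))).
  apply circle_continuity_2d; auto; apply HC; now apply Cmod_circle. }
destruct (bounded_continuity (fun t => Im (H (r * cis t)%C)) 0 (2 * PI)) as [M2 H2].
{ intros t _; apply (continuity_2d_snd (fun r t => Im (H (r * cis t)%C))).
  apply circle_continuity_2d; auto; apply HC; now apply Cmod_circle. }
assert (HM : forall t, 0 <= t <= 2 * PI -> Cmod (H (r * cis t)%C) <= M1 + M2).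
{ intros t Ht; eapply Rle_trans; [apply Cmod_le_sum|].
  apply Rplus_le_compat; left; [now apply H1 | now apply H2]. }
assert (HM0 : 0 <= M1 + M2).
{ eapply Rle_trans; [apply Cmod_ge_0|]; apply (HM 0); generalize PI_RGT_0; lra. }
exists (2 * (M1 + M2)); split; [lra|]; intros g rho Hg Hrho.
rewrite Rmult_assoc; apply circle_mean_bound; [now apply circle_cont_mult|].
intros t Ht; rewrite Cmod_mult; apply Rmult_le_compat; try apply Cmod_ge_0; auto.
now apply Hrho, Cmod_circle.
Qed.

(** Uniform continuity of [H] near the circle; it lets the mean be followed
    across a circle on which [H] is merely continuous. *)
Lemma circle_mean_continuous (H : C -> C) (r0 : R) : 0 < r0 ->
  (exists d, 0 < d /\ forall z, Rabs (Cmod z - r0) < d -> ccont H z) ->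
  forall eps, 0 < eps -> exists delta, 0 < delta /\
    forall r, Rabs (r - r0) < delta ->
      Cmod (circle_mean H r - circle_mean H r0) <= eps.
Proof.
intros Hr0 (d & Hd & HC) eps Heps.
assert (Hpi := PI_RGT_0).
assert (Hcirc : forall r, Rabs (r - r0) < Rmin d r0 -> circle_cont H r).
{ intros r Hr; split.
  - assert (Rabs (r - r0) < r0) by (eapply Rlt_le_trans; [exact Hr | apply Rmin_r]).
    apply Rabs_lt_between in H0; lra.
  - intros z Hz; apply HC; rewrite Hz; eapply Rlt_le_trans; [exact Hr | apply Rmin_l]. }
assert (H0 : Rabs (r0 - r0) < Rmin d r0).
{ rewrite Rminus_eq_0, Rabs_R0; now apply Rmin_pos. }
assert (K : forall g : R -> R -> R,
  (forall t, continuity_2d_pt g r0 t) ->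
  (forall r, Rabs (r - r0) < Rmin d r0 -> ex_RInt (g r) 0 (2 * PI)) ->
  exists delta, 0 < delta /\ forall r, Rabs (r - r0) < delta ->
    Rabs (RInt (g r) 0 (2 * PI) / (2 * PI) - RInt (g r0) 0 (2 * PI) / (2 * PI)) <= eps / 2).
{ intros g Hg Hi.
  assert (He2 : 0 < eps / 2) by lra.
  destruct (uniform_continuity_2d_1d' g 0 (2 * PI) r0 (fun t _ => Hg t) (mkposreal _ He2))
    as [delta Hdelta]; simpl in Hdelta.
  exists (Rmin delta (Rmin d r0)); split.
  { repeat apply Rmin_pos; auto; apply cond_pos. }
  intros r Hr.
  assert (Hr1 : Rabs (r - r0) < delta) by (eapply Rlt_le_trans; [exact Hr | apply Rmin_l]).
  assert (Hr2 : Rabs (r - r0) < Rmin d r0) by (eapply Rlt_le_trans; [exact Hr | apply Rmin_r]).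
  generalize (is_RInt_minus _ _ _ _ _ _
    (@RInt_correct R_CompleteNormedModule _ _ _ (Hi r Hr2))
    (@RInt_correct R_CompleteNormedModule _ _ _ (Hi r0 H0))); intros HI.
  apply (norm_RInt_le_const _ 0 (2 * PI) _ (eps / 2)) in HI; [|lra|].
  - change (Rabs (RInt (g r) 0 (2 * PI) - RInt (g r0) 0 (2 * PI)) <= (2 * PI - 0) * (eps / 2)) in HI.
    unfold Rdiv at 1 2; rewrite <- Rmult_minus_distr_r.
    rewrite Rabs_mult, (Rabs_pos_eq (/ (2 * PI))) by (left; apply Rinv_0_lt_compat; lra).
    apply Rle_div_l; lra.
  - intros t Ht; left; apply Rabs_lt_between in Hr1; generalize (cond_pos delta); intros Hdp.
    apply (Hdelta t r0 t r); try lra.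
    rewrite Rminus_eq_0, Rabs_R0; exact Hdp. }
assert (Hcc : forall t, ccont H (r0 * cis t)%C).
{ intros t; apply (Hcirc r0 H0), Cmod_circle; lra. }
destruct (K (fun r t => Re (H (r * cis t)%C))) as (d1 & Hd1 & K1).
{ intros t; refine (proj1 (circle_continuity_2d H r0 t _ (Hcc t))); lra. }
{ intros r Hr; exact (proj1 (circle_ex_RInt H r (Hcirc r Hr))). }
destruct (K (fun r t => Im (H (r * cis t)%C))) as (d2 & Hd2 & K2).
{ intros t; refine (proj2 (circle_continuity_2d H r0 t _ (Hcc t))); lra. }
{ intros r Hr; exact (proj2 (circle_ex_RInt H r (Hcirc r Hr))). }
exists (Rmin d1 d2); split; [now apply Rmin_pos|]; intros r Hr.
eapply Rle_trans; [apply Cmod_le_sum|].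
replace eps with (eps / 2 + eps / 2) by field; apply Rplus_le_compat;
  [apply K1 | apply K2]; (eapply Rlt_le_trans; [exact Hr|]); [apply Rmin_l | apply Rmin_r].
Qed.

Lemma cis_pow (t : R) (n : nat) : (cis t ^ n)%C = cis (INR n * t).
Proof.
induction n as [|n IH].
- unfold cis; simpl; rewrite Rmult_0_l, cos_0, sin_0; reflexivity.
- rewrite Cpow_S, IH, S_INR; unfold cis, Cmult; cbn [fst snd].
  replace ((INR n + 1) * t) with (t + INR n * t) by ring.
  rewrite cos_plus, sin_plus; f_equal; ring.
Qed.

Lemma cis_inv (t : R) : (/ cis t)%C = cis (- t).
Proof.
assert (E : (cis t * cis (- t))%C = 1).
{ unfold cis, Cmult, RtoC; cbn [fst snd]; rewrite cos_neg, sin_neg; f_equal; [|ring].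
  generalize (sin2_cos2 t); unfold Rsqr; lra. }
assert (N : cis t <> 0) by (apply Cmod_gt_0; rewrite Cmod_cis; lra).
rewrite <- (Cmult_1_r (/ cis t)%C), <- E; field; exact N.
Qed.

Lemma cis_integral_zero (k : Z) : k <> 0%Z ->
  RInt (fun t => cos (IZR k * t)) 0 (2 * PI) = 0 /\
  RInt (fun t => sin (IZR k * t)) 0 (2 * PI) = 0.
Proof.
intros Hk; assert (Hk' : IZR k <> 0) by now apply not_0_IZR.
assert (P : sin (IZR k * (2 * PI)) = 0 /\ cos (IZR k * (2 * PI)) = 1).
{ assert (N : forall n, sin (INR n * (2 * PI)) = 0 /\ cos (INR n * (2 * PI)) = 1).
  { intros n; generalize (sin_period 0 n) (cos_period 0 n).
    rewrite sin_0, cos_0; replace (0 + 2 * INR n * PI) with (INR n * (2 * PI)) by ring; auto. }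
  destruct (Z_le_dec 0 k) as [L|L].
  - rewrite <- (Z2Nat.id k), <- INR_IZR_INZ by exact L; apply N.
  - replace k with (- Z.of_nat (Z.to_nat (- k)))%Z by (rewrite Z2Nat.id; lia).
    rewrite opp_IZR, <- INR_IZR_INZ, Ropp_mult_distr_l_reverse, sin_neg, cos_neg.
    destruct (N (Z.to_nat (- k))) as [-> ->]; split; ring. }
destruct P as [Ps Pc].
split; apply is_RInt_unique.
- replace 0 with (minus (sin (IZR k * (2 * PI)) / IZR k) (sin (IZR k * 0) / IZR k)) at 2.
  2: rewrite Ps, Rmult_0_r, sin_0; unfold minus, plus, opp; simpl; field; exact Hk'.
  apply (is_RInt_derive (fun t => sin (IZR k * t) / IZR k)).
  + intros t _; auto_derive; [trivial | field; exact Hk'].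
  + intros t _; apply (ex_derive_continuous (fun t => cos (IZR k * t))); auto_derive; trivial.
- replace 0 with (minus (- cos (IZR k * (2 * PI)) / IZR k) (- cos (IZR k * 0) / IZR k)) at 2.
  2: rewrite Pc, Rmult_0_r, cos_0; unfold minus, plus, opp; simpl; field; exact Hk'.
  apply (is_RInt_derive (fun t => - cos (IZR k * t) / IZR k)).
  + intros t _; auto_derive; [trivial | field; exact Hk'].
  + intros t _; apply (ex_derive_continuous (fun t => sin (IZR k * t))); auto_derive; trivial.
Qed.

Lemma circle_mean_monomial (H : C -> C) (r rho : R) (k : Z) : k <> 0%Z ->
  (forall t, H (r * cis t)%C = (rho * cis (IZR k * t))%C) -> circle_mean H r = 0.
Proof.
intros Hk HH; destruct (cis_integral_zero k Hk) as [Ec Es].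
assert (Hpi := PI_RGT_0).
assert (S : forall g, ex_RInt g 0 (2 * PI) -> RInt g 0 (2 * PI) = 0 ->
  RInt (fun t => rho * g t) 0 (2 * PI) / (2 * PI) = 0).
{ intros g Hg E.
  generalize (RInt_scal g 0 (2 * PI) rho Hg); unfold scal; simpl; unfold mult; simpl.
  intros ->; rewrite E; field; lra. }
change (RtoC 0) with ((0, 0) : C); unfold circle_mean; f_equal.
- rewrite (RInt_ext _ (fun t => rho * cos (IZR k * t))).
  + apply S; [|exact Ec]; apply (ex_RInt_continuous (fun t => cos (IZR k * t))); intros t _.
    apply (ex_derive_continuous (fun t => cos (IZR k * t))); auto_derive; trivial.
  + intros t _; rewrite HH; unfold cis, Re, Cmult, RtoC; cbn [fst snd].
    match goal with |- ?a = ?b => change (@eq R a b) end; ring.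
- rewrite (RInt_ext _ (fun t => rho * sin (IZR k * t))).
  + apply S; [|exact Es]; apply (ex_RInt_continuous (fun t => sin (IZR k * t))); intros t _.
    apply (ex_derive_continuous (fun t => sin (IZR k * t))); auto_derive; trivial.
  + intros t _; rewrite HH; unfold cis, Im, Cmult, RtoC; cbn [fst snd].
    match goal with |- ?a = ?b => change (@eq R a b) end; ring.
Qed.

Lemma circle_mean_pow (r : R) (n : nat) : (0 < n)%nat ->
  circle_mean (fun z => z ^ n)%C r = 0.
Proof.
intros Hn; apply (circle_mean_monomial _ r (r ^ n) (Z.of_nat n)); [lia|].
intros t; rewrite Cpow_mult_l, cis_pow, RtoC_pow, <- INR_IZR_INZ; reflexivity.
Qed.

Lemma circle_mean_inv_pow (r : R) (n : nat) : 0 < r -> (0 < n)%nat ->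
  circle_mean (fun z => (/ z) ^ n)%C r = 0.
Proof.
intros Hr Hn; apply (circle_mean_monomial _ r ((/ r) ^ n) (- Z.of_nat n)); [lia|].
intros t.
assert (N : cis t <> 0) by (apply Cmod_gt_0; rewrite Cmod_cis; lra).
assert (Nr : RtoC r <> 0) by (apply Cmod_gt_0; rewrite Cmod_R, Rabs_pos_eq; lra).
replace (/ (r * cis t))%C with (/ r * / cis t)%C by (field; auto).
rewrite cis_inv, Cpow_mult_l, cis_pow, RtoC_pow, RtoC_inv by lra.
rewrite opp_IZR, <- INR_IZR_INZ; do 2 f_equal; ring.
Qed.

Lemma circle_mean_const_fun (c : C) (r : R) : circle_mean (fun _ => c) r = c.
Proof.
unfold circle_mean; rewrite !RInt_const; unfold scal; simpl; unfold mult; simpl.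
destruct c as [x y]; unfold Re, Im; simpl; f_equal; field; generalize PI_RGT_0; lra.
Qed.

(** * Laurent expansion of complex functions *)

Definition is_Cseries (a : nat -> C) (l : C) : Prop :=
  @is_series R_AbsRing C_R_NormedModule a l.

(** Convergence is always obtained here from telescoping partial sums, whose
    distance [e] to the limit is geometrically small. *)
Lemma is_Cseries_geometric_error (a e : nat -> C) (l : C) (K rho : R) :
  0 <= rho < 1 ->
  (forall n, @sum_n C_AbelianGroup a n = (l + e n)%C) ->
  (forall n, Cmod (e n) <= K * rho ^ n) -> is_Cseries a l.
Proof.
intros Hrho Ha He; apply filterlim_locally; intros eps.
assert (HK : 0 <= K).
{ generalize (He 0%nat) (Cmod_ge_0 (e 0%nat)); simpl; lra. }
destruct (pow_lt_1_zero rho) with (y := eps / (K + 1)) as [N HN].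
{ rewrite Rabs_pos_eq; lra. }
{ apply Rdiv_lt_0_compat; [apply cond_pos | lra]. }
exists N; intros n Hn.
apply (@norm_compat1 R_AbsRing C_R_NormedModule).
assert (E : (@sum_n C_AbelianGroup a n - l)%C = e n) by (rewrite Ha; ring).
eapply Rle_lt_trans; [right; symmetry; apply Cmod_norm|].
change (Cmod (@sum_n C_AbelianGroup a n - l)%C < eps); rewrite E.
specialize (HN n Hn); rewrite Rabs_pos_eq in HN by (apply pow_le; lra).
eapply Rle_lt_trans; [apply He|].
apply Rlt_div_r in HN; [|lra].
generalize (pow_le rho n (proj1 Hrho)); nra.
Qed.

(** The quotient is completed at [w] by the derivative; continuity of [h] there
    is all that is known at this stage, and all that the means will need. *)
Lemma difference_quotient_exists (F : C -> C) (R1 R2 : R) (w : C) :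
  (forall z, R1 < Cmod z < R2 -> cdiff F z) -> R1 < Cmod w < R2 ->
  exists h : C -> C,
  (forall z, F z = F w + (z - w) * h z)%C /\
  (forall z, R1 < Cmod z < R2 -> ccont h z) /\
  (forall z, R1 < Cmod z < R2 -> z <> w -> cdiff h z).
Proof.
intros HF Hw; destruct (HF w Hw) as (phi & Hphi & d & Hd & Hloc).
pose (h := fun z => if Ceq_dec z w then phi w else ((F z - F w) / (z - w))%C).
assert (Hoff : forall z, z <> w -> cdiff (fun y => (F y - F w) * / (y - w))%C z \/ ~ R1 < Cmod z < R2).
{ intros z Hz; destruct (classic (R1 < Cmod z < R2)) as [A|A]; [left|now right].
  apply (cdiff_mult (fun y => F y - F w)%C (fun y => / (y - w))%C).
  - apply cdiff_minus; [now apply HF | apply cdiff_const].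
  - apply (cdiff_inv (fun y => y - w)%C); [apply cdiff_minus; [apply cdiff_id | apply cdiff_const]|].
    now apply Cminus_eq_contra. }
assert (Hdiff : forall z, R1 < Cmod z < R2 -> z <> w -> cdiff h z).
{ intros z Hz Hzw; destruct (Hoff z Hzw) as [Hc|]; [|contradiction].
  destruct Hc as (psi & Hpsi & d' & Hd' & H').
  assert (P := proj1 (Cmod_gt_0 _) (Cminus_eq_contra _ _ Hzw)).
  exists psi; split; [exact Hpsi|]; exists (Rmin d' (Cmod (z - w))); split;
    [now apply Rmin_pos|]; intros y Hy.
  assert (Hyw : y <> w).
  { intros ->; generalize (Rmin_r d' (Cmod (z - w))); rewrite <- (Cmod_opp (w - z)) in Hy.
    replace (- (w - z))%C with (z - w)%C in Hy by ring; lra. }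
  unfold h; destruct (Ceq_dec y w) as [|_]; [contradiction|].
  destruct (Ceq_dec z w) as [|_]; [contradiction|].
  apply H'; eapply Rlt_le_trans; [exact Hy | apply Rmin_l]. }
exists h; split; [|split; [|exact Hdiff]].
- intros z; unfold h; destruct (Ceq_dec z w) as [->|N]; [ring|].
  field; now apply Cminus_eq_contra.
- intros z Hz; destruct (Ceq_dec z w) as [->|N]; [|now apply cdiff_ccont, Hdiff].
  apply (ccont_ext_loc phi _ _ d Hd); [|exact Hphi].
  intros y Hy; unfold h; destruct (Ceq_dec y w) as [->|N]; [reflexivity|].
  rewrite (Hloc y Hy); field; now apply Cminus_eq_contra.
Qed.

(** Cauchy's contour integrals for the coefficients of [z^n] and [z^-n]: on the
    circle, [dz / (2 PI i z)] is [dt / (2 PI)]. *)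
Definition laurent_pos (F : C -> C) (r : R) (n : nat) : C :=
  circle_mean (fun z => F z * (/ z) ^ n)%C r.
Definition laurent_neg (F : C -> C) (r : R) (n : nat) : C :=
  circle_mean (fun z => F z * z ^ n)%C r.

Lemma Cmod_pos_neq0 (z : C) : 0 < Cmod z -> z <> 0.
Proof. intros H; now apply Cmod_gt_0. Qed.

Lemma circle_cont_pow (r : R) (n : nat) : 0 <= r -> circle_cont (fun z => z ^ n)%C r.
Proof. intros Hr; split; [exact Hr|]; intros z _; apply ccont_pow, ccont_id. Qed.

Lemma circle_cont_inv_pow (r : R) (n : nat) : 0 < r -> circle_cont (fun z => (/ z) ^ n)%C r.
Proof.
intros Hr; split; [lra|]; intros z Hz; apply (ccont_pow (fun z => / z)%C).
apply (ccont_inv (fun z => z)); [apply ccont_id | apply Cmod_pos_neq0; lra].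
Qed.

Lemma circle_cont_const (c : C) (r : R) : 0 <= r -> circle_cont (fun _ => c) r.
Proof. intros Hr; split; [exact Hr|]; intros; apply ccont_const. Qed.

Lemma circle_cont_minus (F G : C -> C) (r : R) :
  circle_cont F r -> circle_cont G r -> circle_cont (fun z => F z - G z)%C r.
Proof.
intros [Hr HF] [_ HG]; split; [exact Hr|]; intros z Hz; apply ccont_minus; auto.
Qed.

Lemma circle_cont_scal (c : C) (F : C -> C) (r : R) :
  circle_cont F r -> circle_cont (fun z => c * F z)%C r.
Proof.
intros HF; apply (circle_cont_mult (fun _ => c)); [|exact HF].
now apply circle_cont_const, HF.
Qed.

(** With [F w] for [c] and [h] the difference quotient at [w], this expresses a
    coefficient of [F] by two consecutive coefficients of [h]; summed against
    powers of [w], the right-hand sides telescope. *)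
Lemma circle_mean_split (F h g : C -> C) (c w : C) (r : R) :
  circle_cont h r -> circle_cont g r ->
  (forall z, F z = c + (z - w) * h z)%C ->
  circle_mean (fun z => F z * g z)%C r =
    (circle_mean (fun z => h z * (z * g z)) r - w * circle_mean (fun z => h z * g z) r
     + c * circle_mean g r)%C.
Proof.
intros Hh Hg HF; assert (Hr := proj1 Hh).
assert (Hid : circle_cont (fun z => z) r) by (split; [exact Hr | intros; apply ccont_id]).
rewrite (circle_mean_ext _
  (fun z => h z * (z * g z) - (w * (h z * g z) - c * g z))%C) by
  (try exact Hr; intros z _; rewrite HF; ring).
rewrite !circle_mean_minus, !circle_mean_scal; [ring|..];
  repeat first [apply circle_cont_scal | apply circle_cont_mult | apply circle_cont_minus];
  assumption.
Qed.

Lemma Ceq_of_small (a b : C) : (forall eps, 0 < eps -> Cmod (a - b) <= eps) -> a = b.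
Proof.
intros H; apply Ceq_minus, Cmod_eq_0.
destruct (Rle_lt_or_eq_dec 0 _ (Cmod_ge_0 (a - b))) as [P|E]; [|now symmetry].
generalize (H (Cmod (a - b) / 2) ltac:(lra)); lra.
Qed.

(** A holomorphic function with exceptional points on one circle, where it is
    continuous, has the same mean inside and outside: the mean is constant on
    each side, and continuous in the radius. *)
Lemma circle_mean_across (H : C -> C) (r1 r0 r2 : R) :
  0 < r1 < r0 -> r0 < r2 ->
  (forall z, r1 <= Cmod z <= r2 -> ccont H z) ->
  (forall z, r1 <= Cmod z <= r2 -> Cmod z <> r0 -> cdiff H z) ->
  circle_mean H r1 = circle_mean H r2.
Proof.
intros Hr1 Hr2 HC HD.
assert (Hc : forall eps, 0 < eps -> exists delta, 0 < delta /\
    forall r, Rabs (r - r0) < delta ->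
      Cmod (circle_mean H r - circle_mean H r0) <= eps).
{ apply circle_mean_continuous; [lra|].
  exists (Rmin (r0 - r1) (r2 - r0)); split; [apply Rmin_pos; lra|].
  intros z Hz; apply Rabs_lt_between in Hz.
  generalize (Rmin_l (r0 - r1) (r2 - r0)) (Rmin_r (r0 - r1) (r2 - r0)); intros.
  apply HC; lra. }
assert (E : forall r, r = r1 \/ r = r2 -> circle_mean H r = circle_mean H r0).
{ intros r Hr; apply Ceq_of_small; intros eps Heps.
  destruct (Hc eps Heps) as (delta & Hd & Hdelta).
  assert (K : exists r', 0 < r' /\ Rabs (r' - r0) < delta /\
    (r = r1 /\ r1 <= r' < r0 \/ r = r2 /\ r0 < r' <= r2)).
  { destruct Hr as [-> | ->].
    - exists (r0 - Rmin (delta / 2) (r0 - r1)).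
      generalize (Rmin_l (delta / 2) (r0 - r1)) (Rmin_r (delta / 2) (r0 - r1))
        (Rmin_pos (delta / 2) (r0 - r1) ltac:(lra) ltac:(lra)); intros.
      split; [lra|]; split; [apply Rabs_def1; lra | left; lra].
    - exists (r0 + Rmin (delta / 2) (r2 - r0)).
      generalize (Rmin_l (delta / 2) (r2 - r0)) (Rmin_r (delta / 2) (r2 - r0))
        (Rmin_pos (delta / 2) (r2 - r0) ltac:(lra) ltac:(lra)); intros.
      split; [lra|]; split; [apply Rabs_def1; lra | right; lra]. }
  destruct K as (r' & Hr' & Hclose & Hcase).
  rewrite (circle_mean_const H r r').
  - now apply Hdelta.
  - lra.
  - exact Hr'.
  - intros z Hz; apply HD; destruct Hcase as [[-> Hc']|[-> Hc']];
      [rewrite Rmin_left, Rmax_right in Hz by lra | rewrite Rmin_right, Rmax_left in Hz by lra |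
       rewrite Rmin_left, Rmax_right in Hz by lra | rewrite Rmin_right, Rmax_left in Hz by lra];
      lra. }
rewrite (E r1), (E r2); auto.
Qed.

(** Let [p n] and [q n] be the means of [h(z) z^-n] on a circle outside [w] and
    of [h(z) z^n] on a circle inside [w].  The coefficients of [F] are
    differences of consecutive [p] or [q], up to the factor [w], so the
    partial sums of the two halves are [F w + q 1 - w^(n+1) p n] and
    [w^-(n+1) q (n+2) - q 1].  The Cauchy estimate makes the error terms
    geometric, because the circles lie on the favourable sides of [w]. *)
Theorem complex_laurent (F : C -> C) (R1 R2 r : R) :
  0 <= R1 -> R1 < r < R2 -> (forall z, R1 < Cmod z < R2 -> cdiff F z) ->
  forall w, R1 < Cmod w < R2 -> exists l1 l2,
    F w = (l1 + l2)%C /\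
    is_Cseries (fun n => w ^ n * laurent_pos F r n)%C l1 /\
    is_Cseries (fun n => (/ w) ^ (S n) * laurent_neg F r (S n))%C l2.
Proof.
intros HR1 Hr HF w Hw.
destruct (difference_quotient_exists F R1 R2 w HF Hw) as (h & Hh & Hhc & Hhd).
set (m := Cmod w) in *.
set (ro := (m + R2) / 2); set (ri := (R1 + m) / 2).
assert (Hro : m < ro < R2) by (unfold ro; lra).
assert (Hri : R1 < ri < m) by (unfold ri; lra).
assert (Hm : 0 < m) by lra.
assert (wnz : w <> 0) by (apply Cmod_pos_neq0; fold m; lra).
assert (Hhcirc : forall s, R1 < s < R2 -> circle_cont h s).
{ intros s Hs; split; [lra|]; intros z Hz; apply Hhc; lra. }
pose (p := fun n => circle_mean (fun z => h z * (/ z) ^ n)%C ro).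
pose (q := fun n => circle_mean (fun z => h z * z ^ n)%C ri).
assert (Hmove : forall g s s', R1 < s < R2 -> R1 < s' < R2 ->
  (forall z, R1 < Cmod z -> cdiff g z) ->
  circle_mean (fun z => F z * g z)%C s = circle_mean (fun z => F z * g z)%C s').
{ intros g s s' Hs Hs' Hg; apply circle_mean_const; [lra|lra|].
  intros z Hz.
  assert (R1 < Cmod z < R2).
  { generalize (Rmin_glb_lt s s' R1) (Rmax_lub_lt s s' R2); lra. }
  apply cdiff_mult; [now apply HF | now apply Hg]. }
(* the single coefficient of h needed on both sides of w *)
assert (Hcross : circle_mean (fun z => h z * z)%C ro = q 1%nat).
{ unfold q; rewrite <- (circle_mean_across (fun z => h z * z)%C ri m ro); try lra.
  - apply circle_mean_ext; [lra|]; intros z _; simpl; ring.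
  - intros z Hz; apply ccont_mult; [apply Hhc; lra | apply ccont_id].
  - intros z Hz Hzm; apply cdiff_mult; [|apply cdiff_id].
    apply Hhd; [lra|]; now intros ->. }
assert (U0 : laurent_pos F r 0 = (F w + q 1%nat - w * p 0%nat)%C).
{ unfold laurent_pos; rewrite (Hmove _ r ro) by (try lra; intros z _; exact (cdiff_const 1 z)).
  rewrite (circle_mean_split F h _ (F w) w) by
    first [exact Hh | apply Hhcirc; lra | exact (circle_cont_const 1 ro ltac:(lra))].
  change (circle_mean (fun z => (/ z) ^ 0)%C ro) with (circle_mean (fun _ => RtoC 1) ro).
  rewrite circle_mean_const_fun, <- Hcross.
  rewrite (circle_mean_ext _ (fun z => h z * z)%C) by (try lra; intros; simpl; ring).
  fold (p 0%nat); ring. }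
assert (invdiff : forall n z, R1 < Cmod z -> cdiff (fun z => (/ z) ^ n)%C z).
{ intros n z Hz; apply (cdiff_pow (fun z => / z)%C).
  apply (cdiff_inv (fun z => z)); [apply cdiff_id | apply Cmod_pos_neq0; lra]. }
assert (US : forall n, laurent_pos F r (S n) = (p n - w * p (S n))%C).
{ intros n; unfold laurent_pos.
  rewrite (Hmove _ r ro) by (try lra; apply invdiff).
  rewrite (circle_mean_split F h _ (F w) w) by
    first [exact Hh | apply Hhcirc; lra | apply circle_cont_inv_pow; lra].
  rewrite circle_mean_inv_pow by (lra || lia).
  rewrite (circle_mean_ext _ (fun z => h z * (/ z) ^ n)%C).
  - fold (p n) (p (S n)); ring.
  - lra.
  - intros z Hz; rewrite Cpow_S; field; apply Cmod_pos_neq0; lra. }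
assert (V : forall n, laurent_neg F r (S n) = (q (S (S n)) - w * q (S n))%C).
{ intros n; unfold laurent_neg.
  rewrite (Hmove _ r ri) by (try lra; intros; apply (cdiff_pow (fun z => z)), cdiff_id).
  rewrite (circle_mean_split F h _ (F w) w) by
    first [exact Hh | apply Hhcirc; lra | apply circle_cont_pow; lra].
  rewrite circle_mean_pow by lia.
  change (circle_mean (fun z => h z * (z * z ^ S n))%C ri) with (q (S (S n))).
  fold (q (S n)); ring. }
destruct (circle_mean_weight_bound h ro) as (Bo & HBo & Ho); [apply Hhcirc; lra|].
destruct (circle_mean_weight_bound h ri) as (Bi & HBi & Hi); [apply Hhcirc; lra|].
exists (F w + q 1%nat)%C, (- q 1%nat)%C; split; [ring|]; split.
- apply (is_Cseries_geometric_error _ (fun n => - (w ^ S n * p n))%C _ (m * Bo) (m / ro)).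
  + split; [apply Rdiv_le_0_compat | apply Rlt_div_l]; lra.
  + induction n as [|n IH].
    * rewrite sum_O, U0; match goal with |- ?a = ?b => change (@eq C a b) end.
      simpl; ring.
    * rewrite sum_Sn, IH, US; match goal with |- plus ?a ?b = ?c => change (a + b = c)%C end.
      rewrite !Cpow_S; ring.
  + intros n; rewrite Cmod_opp, Cmod_mult, Cmod_pow; fold m.
    assert (Hp : Cmod (p n) <= Bo * (/ ro) ^ n).
    { apply (Ho (fun z => (/ z) ^ n)%C ((/ ro) ^ n)); [apply circle_cont_inv_pow; lra|].
      intros z Hz.
      rewrite Cmod_pow, Cmod_inv, Hz by (apply Cmod_pos_neq0; lra); lra. }
    unfold Rdiv; rewrite Rpow_mult_distr; simpl.
    replace (m * Bo * (m ^ n * (/ ro) ^ n)) with (m * m ^ n * (Bo * (/ ro) ^ n)) by ring.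
    apply Rmult_le_compat_l; [|exact Hp].
    apply Rmult_le_pos; [lra | apply pow_le; lra].
- apply (is_Cseries_geometric_error _ (fun n => (/ w) ^ S n * q (S (S n)))%C _
    (Bi * ri ^ 2 / m) (ri / m)).
  + split; [apply Rdiv_le_0_compat | apply Rlt_div_l]; lra.
  + induction n as [|n IH].
    * rewrite sum_O, V; match goal with |- ?a = ?b => change (@eq C a b) end.
      simpl; field; exact wnz.
    * rewrite sum_Sn, IH, V; match goal with |- plus ?a ?b = ?c => change (a + b = c)%C end.
      rewrite !(Cpow_S _ (S n)); field; exact wnz.
  + intros n; rewrite Cmod_mult, Cmod_pow, Cmod_inv by exact wnz; fold m.
    assert (Hq : Cmod (q (S (S n))) <= Bi * ri ^ (S (S n))).
    { apply (Hi (fun z => z ^ S (S n))%C (ri ^ S (S n))); [apply circle_cont_pow; lra|].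
      intros z Hz.
      rewrite Cmod_pow, Hz; lra. }
    unfold Rdiv; rewrite Rpow_mult_distr; simpl in *.
    replace (Bi * (ri * (ri * 1)) * / m * (ri ^ n * (/ m) ^ n)) with
      (/ m * (/ m) ^ n * (Bi * (ri * (ri * ri ^ n)))) by ring.
    apply Rmult_le_compat_l; [|exact Hq].
    assert (0 < / m) by (apply Rinv_0_lt_compat; lra).
    apply Rmult_le_pos; [lra | apply pow_le; lra].
Qed.

(** * Taylor expansion and the identity theorem *)

Lemma is_Cseries_Re_Im (a : nat -> C) (l : C) : is_Cseries a l ->
  is_series (fun n => Re (a n)) (Re l) /\ is_series (fun n => Im (a n)) (Im l).
Proof.
intros H; split.
- apply filterlim_ext with (fun n => fst (@sum_n C_AbelianGroup a n)).
  + induction x as [|n IH]; [now rewrite !sum_O|].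
    rewrite !sum_Sn, <- IH; reflexivity.
  + eapply filterlim_comp; [exact H|]; destruct l as [x y].
    exact (@continuous_fst R_UniformSpace R_UniformSpace x y).
- apply filterlim_ext with (fun n => snd (@sum_n C_AbelianGroup a n)).
  + induction x as [|n IH]; [now rewrite !sum_O|].
    rewrite !sum_Sn, <- IH; reflexivity.
  + eapply filterlim_comp; [exact H|]; destruct l as [x y].
    exact (@continuous_snd R_UniformSpace R_UniformSpace x y).
Qed.

Lemma is_Cseries_zero (a : nat -> C) (l : C) :
  (forall n, a n = 0) -> is_Cseries a l -> l = 0.
Proof.
intros Ha Hl; apply is_Cseries_Re_Im in Hl; destruct Hl as [H1 H2].
assert (Z : is_series (fun _ : nat => 0) 0).
{ apply filterlim_ext with (fun _ => 0); [|apply filterlim_const].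
  intros n; symmetry; rewrite sum_n_const; ring. }
apply is_series_unique in Z.
apply (is_series_ext _ (fun _ => 0)) in H1; [|intros n; now rewrite Ha].
apply (is_series_ext _ (fun _ => 0)) in H2; [|intros n; now rewrite Ha].
apply is_series_unique in H1, H2.
destruct l as [x y]; unfold Re, Im, RtoC in *; simpl in *; f_equal; congruence.
Qed.

(** The punctured neighbourhood matters: the Taylor expansion below comes from
    a Laurent expansion and says nothing at the centre, so the value at [0] is
    recovered by continuity. *)
Lemma pseries_zero_coeff (a : nat -> R) (eta : R) : 0 < eta ->
  (forall x, 0 < Rabs x < eta -> is_pseries a x 0) -> forall n, a n = 0.
Proof.
intros Heta Ha.
assert (Hcv : Rbar_lt 0 (CV_radius a)).
{ apply Rbar_lt_le_trans with (Rabs (eta / 2)).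
  - simpl; rewrite Rabs_pos_eq; lra.
  - apply Rbar_not_lt_le; intros N; apply CV_disk_outside in N; apply N.
    assert (Hs := Ha (eta / 2)); rewrite Rabs_pos_eq in Hs by lra.
    specialize (Hs ltac:(lra)).
    apply is_lim_seq_ext with (fun n => scal (pow_n (eta / 2) n) (a n)).
    + intros n; rewrite pow_n_pow; unfold scal; simpl; unfold mult; simpl; ring.
    + apply ex_series_lim_0; exists 0; exact Hs. }
assert (Hps : forall x, 0 < Rabs x < eta -> PSeries a x = 0).
{ intros x Hx; now apply is_pseries_unique, Ha. }
assert (H0 : PSeries a 0 = 0).
{ destruct (Req_dec (PSeries a 0) 0) as [E|E]; [exact E|exfalso].
  assert (Hc : continuity_pt (PSeries a) 0) by (apply PSeries_continuity; now rewrite Rabs_R0).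
  assert (Hc' := proj1 (continuity_pt_locally _ _) Hc).
  destruct (Hc' (mkposreal _ (Rabs_pos_lt _ E))) as [d Hd]; simpl in Hd.
  assert (Hdp := cond_pos d).
  assert (P : 0 < Rmin d eta) by now apply Rmin_pos.
  generalize (Rmin_l d eta) (Rmin_r d eta); intros L1 L2.
  specialize (Hd (Rmin d eta / 2)).
  rewrite Hps in Hd by (rewrite Rabs_pos_eq; lra).
  rewrite Rminus_0_l, Rabs_Ropp in Hd; apply Rlt_irrefl with (Rabs (PSeries a 0)).
  apply Hd; unfold ball; simpl; unfold AbsRing_ball, abs, minus, plus, opp; simpl.
  rewrite Rabs_pos_eq; lra. }
intros n; apply (PSeries_ext_recip a (fun _ => 0)).
- exact Hcv.
- now rewrite CV_radius_const_0.
- exists (mkposreal _ Heta); intros x Hx.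
  change (Rabs (x - 0) < eta) in Hx; rewrite Rminus_0_r in Hx.
  rewrite PSeries_const_0.
  destruct (Req_dec x 0) as [->|N]; [exact H0|].
  apply Hps; split; [now apply Rabs_pos_lt | exact Hx].
Qed.

(** The removable singularity theorem: the mean of [G(z) z^(n+1)] does not
    depend on the radius and tends to [0] with it. *)
Lemma laurent_neg_zero (G : C -> C) (rho r : R) (n : nat) :
  (forall z, Cmod z < rho -> cdiff G z) -> 0 < r < rho ->
  laurent_neg G r (S n) = 0.
Proof.
intros HG Hr; apply Ceq_of_small; intros eps Heps.
assert (HG0 : ccont G 0) by (apply cdiff_ccont, HG; rewrite Cmod_0; lra).
destruct (HG0 1 Rlt_0_1) as (d & Hd & HB).
set (B := Cmod (G 0) + 1).
assert (HB0 : 1 <= B) by (unfold B; generalize (Cmod_ge_0 (G 0)); lra).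
assert (E0 : 0 < eps / (2 * B)) by (apply Rdiv_lt_0_compat; lra).
set (s := Rmin (Rmin (d / 2) r) (Rmin 1 (eps / (2 * B)))).
assert (Hs : 0 < s) by (unfold s; repeat apply Rmin_pos; lra).
assert (s <= d / 2 /\ s <= r /\ s <= 1 /\ s <= eps / (2 * B)) as (S1 & S2 & S3 & S4).
{ unfold s; generalize (Rmin_l (Rmin (d / 2) r) (Rmin 1 (eps / (2 * B))))
    (Rmin_r (Rmin (d / 2) r) (Rmin 1 (eps / (2 * B))))
    (Rmin_l (d / 2) r) (Rmin_r (d / 2) r) (Rmin_l 1 (eps / (2 * B)))
    (Rmin_r 1 (eps / (2 * B))); lra. }
assert (HcG : circle_cont (fun z => G z * z ^ S n)%C s).
{ apply circle_cont_mult; [|apply circle_cont_pow; lra].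
  split; [lra|]; intros z Hz; apply cdiff_ccont, HG; lra. }
assert (Em : laurent_neg G r (S n) = laurent_neg G s (S n)).
{ apply circle_mean_const; try lra; intros z Hz.
  rewrite Rmin_right, Rmax_left in Hz by lra.
  apply cdiff_mult; [apply HG; lra | apply (cdiff_pow (fun z => z)), cdiff_id]. }
rewrite Em; replace (laurent_neg G s (S n) - 0)%C with (laurent_neg G s (S n)) by ring.
eapply Rle_trans; [apply (circle_mean_bound _ _ (B * s) HcG)|].
- intros t _; rewrite Cmod_mult, Cmod_pow, Cmod_circle by lra.
  apply Rmult_le_compat; try apply Cmod_ge_0; [apply pow_le; lra| |].
  + assert (Hz : Cmod (s * cis t - 0) < d).
    { replace (s * cis t - 0)%C with (s * cis t)%C by ring; rewrite Cmod_circle; lra. }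
    specialize (HB _ Hz).
    generalize (Cmod_triangle (G (s * cis t)%C - G 0) (G 0)).
    replace (G (s * cis t)%C - G 0 + G 0)%C with (G (s * cis t)%C) by ring.
    unfold B; lra.
  + assert (Hpow : s ^ n <= 1) by (rewrite <- (pow1 n); apply pow_incr; lra).
    simpl; nra.
- apply Rle_trans with (2 * B * (eps / (2 * B))).
  + rewrite <- Rmult_assoc; apply Rmult_le_compat_l; lra.
  + right; field; lra.
Qed.

(** The Laurent expansion in the punctured disc around [c], whose principal
    part vanishes. *)
Lemma complex_taylor (F : C -> C) (c : C) (rho r : R) :
  0 < r < rho -> (forall z, Cmod (z - c) < rho -> cdiff F z) ->
  forall z, 0 < Cmod z < rho ->
    is_Cseries (fun n => z ^ n * laurent_pos (fun y => F (c + y)%C) r n)%C (F (c + z)%C).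
Proof.
intros Hr HF z Hz; set (G := fun y => F (c + y)%C).
assert (HG : forall y, Cmod y < rho -> cdiff G y).
{ intros y Hy; apply (cdiff_shift F), HF.
  replace (c + y - c)%C with y by ring; exact Hy. }
destruct (complex_laurent G 0 rho r) with (w := z) as (l1 & l2 & E & H1 & H2); try lra.
{ intros y Hy; apply HG; lra. }
apply is_Cseries_zero in H2.
- change (F (c + z)%C) with (G z); rewrite E, H2, Cplus_0_r; exact H1.
- intros n; rewrite (laurent_neg_zero G rho) by assumption; ring.
Qed.

(** The real and imaginary parts of the Taylor coefficients at [c] are the
    coefficients of two real power series that vanish on an interval. *)
Lemma identity_disc (F : C -> C) (c : C) (rho eps : R) :
  0 < rho -> 0 < eps -> (forall z, Cmod (z - c) < rho -> cdiff F z) ->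
  (forall x : R, Rabs x < eps -> F (c + x)%C = 0) ->
  forall z, Cmod (z - c) < rho -> F z = 0.
Proof.
intros Hrho Heps HF H0 z Hz.
set (u := laurent_pos (fun y => F (c + y)%C) (rho / 2)).
assert (HT := complex_taylor F c rho (rho / 2) ltac:(lra) HF).
assert (Hu : forall n, u n = 0).
{ assert (Hx : forall x : R, 0 < Rabs x < Rmin eps rho ->
    is_Cseries (fun n => x ^ n * u n)%C 0).
  { intros x Hx; generalize (Rmin_l eps rho) (Rmin_r eps rho); intros.
    rewrite <- (H0 x) by lra; apply HT; rewrite Cmod_R; lra. }
  assert (P : 0 < Rmin eps rho) by now apply Rmin_pos.
  assert (HR : forall n, Re (u n) = 0).
  { apply (pseries_zero_coeff _ _ P); intros x Hx'.
    apply (is_series_ext (fun n => Re (x ^ n * u n)%C)).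
    - intros n; transitivity (x ^ n * Re (u n))%R.
      + rewrite <- re_scal_l, RtoC_pow; reflexivity.
      + rewrite <- pow_n_pow; reflexivity.
    - apply (is_Cseries_Re_Im _ _ (Hx x Hx')). }
  assert (HI : forall n, Im (u n) = 0).
  { apply (pseries_zero_coeff _ _ P); intros x Hx'.
    apply (is_series_ext (fun n => Im (x ^ n * u n)%C)).
    - intros n; transitivity (x ^ n * Im (u n))%R.
      + rewrite <- im_scal_l, RtoC_pow; reflexivity.
      + rewrite <- pow_n_pow; reflexivity.
    - apply (is_Cseries_Re_Im _ _ (Hx x Hx')). }
  intros n; specialize (HR n); specialize (HI n); destruct (u n) as [x y].
  unfold Re, Im, RtoC in *; simpl in *; now subst. }
replace z with (c + (z - c))%C by ring.
destruct (Ceq_dec (z - c) 0) as [->|N].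
- apply (H0 0); now rewrite Rabs_R0.
- apply (is_Cseries_zero (fun n => (z - c) ^ n * u n)%C).
  + intros n; rewrite Hu; ring.
  + apply HT; split; [now apply Cmod_gt_0 | exact Hz].
Qed.

Lemma cis_lipschitz (s t : R) : Cmod (cis s - cis t) <= 2 * Rabs (s - t).
Proof.
assert (K : forall f df : R -> R, (forall x, is_derive f x (df x)) ->
  (forall x, Rabs (df x) <= 1) -> Rabs (f s - f t) <= Rabs (s - t)).
{ intros f df Hf Hdf; destruct (MVT_gen f t s df) as (x & _ & E).
  - intros x _; apply Hf.
  - intros x _; apply continuity_pt_filterlim, (ex_derive_continuous f); now exists (df x).
  - rewrite E, Rabs_mult; generalize (Hdf x) (Rabs_pos (s - t)); nra. }
eapply Rle_trans; [apply Cmod_le_sum|].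
replace (2 * Rabs (s - t)) with (Rabs (s - t) + Rabs (s - t)) by ring.
apply Rplus_le_compat.
- apply (K cos (fun x => - sin x)).
  + intros x; apply is_derive_Reals, derivable_pt_lim_cos.
  + intros x; rewrite Rabs_Ropp; apply Rabs_le, SIN_bound.
- apply (K sin cos).
  + intros x; apply is_derive_Reals, derivable_pt_lim_sin.
  + intros x; apply Rabs_le, COS_bound.
Qed.

Lemma polar_form (z : C) : exists t, z = (Cmod z * cis t)%C.
Proof.
destruct (Ceq_dec z 0) as [->|N].
{ exists 0; rewrite Cmod_0; ring. }
apply Cmod_gt_0 in N; set (m := Cmod z) in *.
destruct z as [x y].
assert (Hm : m ^ 2 = x ^ 2 + y ^ 2).
{ unfold m, Cmod; rewrite pow2_sqrt; [reflexivity|]; simpl.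
  generalize (pow2_ge_0 x) (pow2_ge_0 y); simpl; lra. }
assert (Hx : -1 <= x / m <= 1).
{ split; [apply Rle_div_r | apply Rle_div_l]; try lra; nra. }
assert (Hs : m * sqrt (1 - (x / m)²) = Rabs y).
{ rewrite <- (sqrt_pow2 m) at 1 by lra; rewrite <- sqrt_mult_alt by apply pow2_ge_0.
  replace (m ^ 2 * (1 - (x / m)²)) with (y²).
  - apply sqrt_Rsqr_abs.
  - unfold Rsqr; replace (m ^ 2 * (1 - x / m * (x / m))) with (m ^ 2 - x ^ 2) by (field; lra).
    rewrite Hm; ring. }
assert (Hc : m * (x / m) = x) by (field; lra).
destruct (Rle_dec 0 y) as [L|L].
- exists (acos (x / m)); unfold cis; rewrite cos_acos, sin_acos by exact Hx.
  unfold Cmult, RtoC; simpl; f_equal.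
  + rewrite <- Hc at 1; ring.
  + rewrite Hs, Rabs_pos_eq by exact L; ring.
- exists (- acos (x / m)); unfold cis; rewrite cos_neg, sin_neg, cos_acos, sin_acos by exact Hx.
  unfold Cmult, RtoC; simpl; f_equal.
  + rewrite <- Hc at 1; ring.
  + rewrite Ropp_mult_distr_r_reverse, Hs, Rabs_left by lra; ring.
Qed.

(** Analytic continuation along the circle through [z], from its point on the
    positive real axis: discs of the common radius [rho], with centres closer
    than [rho] to each other, transport the vanishing step by step. *)
Lemma identity_annulus (F : C -> C) (R1 R2 : R) :
  0 <= R1 -> (forall z, R1 < Cmod z < R2 -> cdiff F z) ->
  (forall x : R, R1 < x < R2 -> F x = 0) ->
  forall z, R1 < Cmod z < R2 -> F z = 0.
Proof.
intros HR1 HF H0 z Hz.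
destruct (polar_form z) as [t Et]; set (r := Cmod z) in *.
set (rho := Rmin (r - R1) (R2 - r)).
assert (Hrho : 0 < rho) by (apply Rmin_pos; lra).
assert (Hr1 : rho <= r - R1) by apply Rmin_l.
assert (Hr2 : rho <= R2 - r) by apply Rmin_r.
assert (Hdisc : forall s y, Cmod (y - r * cis s) < rho -> R1 < Cmod y < R2).
{ intros s y Hy; assert (Hc : Cmod (r * cis s) = r) by (apply Cmod_circle; lra).
  generalize (Cmod_triangle (y - r * cis s) (r * cis s))
    (Cmod_triangle (- (y - r * cis s)) y).
  rewrite Cmod_opp.
  replace (y - r * cis s + r * cis s)%C with y by ring.
  replace (- (y - r * cis s) + y)%C with (r * cis s)%C by ring; lra. }
(* S N steps of angle t / S N make consecutive centres closer than rho *)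
destruct (nfloor_ex (2 * r * Rabs t / rho)) as [N [_ HN]].
{ apply Rdiv_le_0_compat; [|exact Hrho].
  apply Rmult_le_pos; [lra | apply Rabs_pos]. }
assert (HN1 : 0 < INR (S N)) by (apply lt_0_INR; lia).
set (step := t / INR (S N)).
assert (Hstep : 2 * r * Rabs step < rho).
{ unfold step, Rdiv; rewrite Rabs_mult, Rabs_inv, (Rabs_pos_eq (INR (S N))) by lra.
  rewrite <- Rmult_assoc; apply Rlt_div_l; [exact HN1|].
  apply Rlt_div_l in HN; [|exact Hrho]; rewrite S_INR; lra. }
assert (Hind : forall k y, Cmod (y - r * cis (INR k * step)) < rho -> F y = 0).
{ induction k as [|k IH].
  - apply (identity_disc F _ rho rho); auto.
    + intros y Hy; now apply HF, (Hdisc (INR 0 * step)).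
    + intros x Hx; simpl (INR 0); rewrite Rmult_0_l.
      replace (r * cis 0 + x)%C with (RtoC (r + x)).
      * apply H0; apply Rabs_lt_between in Hx; lra.
      * unfold cis; rewrite cos_0, sin_0; unfold RtoC, Cmult, Cplus; simpl; f_equal; ring.
  - set (c := (r * cis (INR k * step))%C) in *.
    set (c' := (r * cis (INR (S k) * step))%C).
    assert (Hcc : Cmod (c' - c) <= 2 * r * Rabs step).
    { unfold c, c'.
      replace (r * cis (INR (S k) * step) - r * cis (INR k * step))%C with
        (r * (cis (INR (S k) * step) - cis (INR k * step)))%C by ring.
      rewrite Cmod_mult, Cmod_R, Rabs_pos_eq by lra.
      replace (2 * r * Rabs step) with (r * (2 * Rabs step)) by ring.
      apply Rmult_le_compat_l; [lra|].
      eapply Rle_trans; [apply cis_lipschitz|]; right; do 2 f_equal.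
      rewrite S_INR; ring. }
    apply (identity_disc F c' rho (rho - 2 * r * Rabs step)); [exact Hrho | lra | |].
    + intros y Hy; now apply HF, (Hdisc (INR (S k) * step)).
    + intros x Hx; apply IH.
      replace (c' + x - c)%C with ((c' - c) + x)%C by ring.
      eapply Rle_lt_trans; [apply Cmod_triangle|]; rewrite Cmod_R; lra. }
apply (Hind (S N)).
replace (INR (S N) * step) with t by (unfold step; field; lra).
rewrite <- Et, Cmod_self_minus; exact Hrho.
Qed.

(** * Quaternions and their slices *)

Lemma mult_coords (p q : quat) :
  q0 (mult p q) = q0 p * q0 q - q1 p * q1 q - q2 p * q2 q - q3 p * q3 q /\
  q1 (mult p q) = q0 p * q1 q + q1 p * q0 q + q2 p * q3 q - q3 p * q2 q /\
  q2 (mult p q) = q0 p * q2 q - q1 p * q3 q + q2 p * q0 q + q3 p * q1 q /\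
  q3 (mult p q) = q0 p * q3 q + q1 p * q2 q - q2 p * q1 q + q3 p * q0 q.
Proof. repeat split. Qed.

Lemma plus_coords (p q : quat) :
  q0 (plus p q) = q0 p + q0 q /\ q1 (plus p q) = q1 p + q1 q /\
  q2 (plus p q) = q2 p + q2 q /\ q3 (plus p q) = q3 p + q3 q.
Proof. repeat split. Qed.

Lemma opp_coords (p : quat) :
  q0 (opp p) = - q0 p /\ q1 (opp p) = - q1 p /\ q2 (opp p) = - q2 p /\ q3 (opp p) = - q3 p.
Proof. repeat split. Qed.

Lemma scal_coords (k : R) (p : quat) :
  q0 (scal k p) = k * q0 p /\ q1 (scal k p) = k * q1 p /\
  q2 (scal k p) = k * q2 p /\ q3 (scal k p) = k * q3 p.
Proof. repeat split. Qed.

Lemma mkq_coords (a b c d : R) :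
  q0 (mkq a b c d) = a /\ q1 (mkq a b c d) = b /\ q2 (mkq a b c d) = c /\ q3 (mkq a b c d) = d.
Proof. repeat split. Qed.

Lemma minus_coords (p q : quat) :
  q0 (minus p q) = q0 p - q0 q /\ q1 (minus p q) = q1 p - q1 q /\
  q2 (minus p q) = q2 p - q2 q /\ q3 (minus p q) = q3 p - q3 q.
Proof. repeat split. Qed.

(** For an imaginary unit [I], the embedding of [C] into the quaternions that
    sends the complex unit to [I]. *)
Definition slice (I : quat) (z : C) : quat := slice_pt I (Re z) (Im z).

Lemma slice_coords (I : quat) (z : C) :
  q0 (slice I z) = Re z + q0 I * Im z /\ q1 (slice I z) = q1 I * Im z /\
  q2 (slice I z) = q2 I * Im z /\ q3 (slice I z) = q3 I * Im z.
Proof.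
unfold slice, slice_pt, mult, plus; simpl; unfold qmult, RtoQ, plus; simpl.
unfold mkq, q0, q1, q2, q3; simpl; unfold plus; simpl.
repeat split; ring.
Qed.

#[local] Hint Rewrite
  (fun p q => proj1 (mult_coords p q))
  (fun p q => proj1 (proj2 (mult_coords p q)))
  (fun p q => proj1 (proj2 (proj2 (mult_coords p q))))
  (fun p q => proj2 (proj2 (proj2 (mult_coords p q))))
  (fun p q => proj1 (plus_coords p q))
  (fun p q => proj1 (proj2 (plus_coords p q)))
  (fun p q => proj1 (proj2 (proj2 (plus_coords p q))))
  (fun p q => proj2 (proj2 (proj2 (plus_coords p q))))
  (fun p q => proj1 (minus_coords p q))
  (fun p q => proj1 (proj2 (minus_coords p q)))
  (fun p q => proj1 (proj2 (proj2 (minus_coords p q))))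
  (fun p q => proj2 (proj2 (proj2 (minus_coords p q))))
  (fun p => proj1 (opp_coords p))
  (fun p => proj1 (proj2 (opp_coords p)))
  (fun p => proj1 (proj2 (proj2 (opp_coords p))))
  (fun p => proj2 (proj2 (proj2 (opp_coords p))))
  (fun p q => proj1 (scal_coords p q))
  (fun p q => proj1 (proj2 (scal_coords p q)))
  (fun p q => proj1 (proj2 (proj2 (scal_coords p q))))
  (fun p q => proj2 (proj2 (proj2 (scal_coords p q))))
  (fun p q => proj1 (slice_coords p q))
  (fun p q => proj1 (proj2 (slice_coords p q)))
  (fun p q => proj1 (proj2 (proj2 (slice_coords p q))))
  (fun p q => proj2 (proj2 (proj2 (slice_coords p q)))) : quat_coords.

Ltac qcoords := autorewrite with quat_coords;
  change (q0 one) with 1; change (q1 one) with 0; change (q2 one) with 0;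
  change (q3 one) with 0; change (q0 zero) with 0; change (q1 zero) with 0;
  change (q2 zero) with 0; change (q3 zero) with 0.

Lemma imag_unit_coords (I : quat) : imag_unit I ->
  q0 I = 0 /\ q1 I ^ 2 + q2 I ^ 2 + q3 I ^ 2 = 1.
Proof.
intros H; unfold imag_unit in H.
assert (E0 := f_equal q0 H); assert (E1 := f_equal q1 H);
  assert (E2 := f_equal q2 H); assert (E3 := f_equal q3 H).
revert E0 E1 E2 E3; qcoords.
intros E0 E1 E2 E3.
assert (D : q0 I = 0).
{ destruct (Req_dec (q0 I) 0) as [E|N]; [exact E|exfalso].
  assert (q1 I = 0) by nra. assert (q2 I = 0) by nra. assert (q3 I = 0) by nra. nra. }
split; [exact D|]; rewrite D in E0; nra.
Qed.

Lemma imag_unit_opp (I : quat) : imag_unit I -> imag_unit (opp I).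
Proof.
unfold imag_unit; intros H; rewrite <- H; apply quat_eq; qcoords; ring.
Qed.

Lemma slice_opp (I : quat) (z : C) : slice (opp I) z = slice I (Cconj z).
Proof. apply quat_eq; qcoords; unfold Cconj, Re, Im; simpl; ring. Qed.

Lemma slice_mult (I : quat) (z w : C) : imag_unit I ->
  slice I (z * w)%C = mult (slice I z) (slice I w).
Proof.
intros HI; destruct (imag_unit_coords I HI) as [H0 H1].
apply quat_eq; qcoords; rewrite ?H0, ?re_mult, ?im_mult; try ring.
replace (Re z * Re w - Im z * Im w) with
  (Re z * Re w - (q1 I ^ 2 + q2 I ^ 2 + q3 I ^ 2) * (Im z * Im w)) by (rewrite H1; ring).
ring.
Qed.

Lemma slice_minus (I : quat) (z w : C) : slice I (z - w)%C = minus (slice I z) (slice I w).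
Proof. apply quat_eq; qcoords; unfold Cminus; rewrite ?re_plus, ?im_plus, ?re_opp, ?im_opp; ring. Qed.

Lemma slice_one (I : quat) : slice I 1 = one.
Proof.
apply quat_eq; qcoords; unfold Re, Im, RtoC; simpl fst; simpl snd; ring.
Qed.

Lemma slice_pow (I : quat) (z : C) (n : nat) : imag_unit I ->
  slice I (z ^ n)%C = pow_n (slice I z) n.
Proof.
intros HI; induction n as [|n IH]; [apply slice_one|].
rewrite Cpow_S, slice_mult, IH by exact HI; reflexivity.
Qed.

Lemma qabs_slice (I : quat) (z : C) : imag_unit I -> qabs (slice I z) = Cmod z.
Proof.
intros HI; destruct (imag_unit_coords I HI) as [H0 H1].
unfold qabs, Cmod; f_equal; qcoords; rewrite H0.
change (fst z) with (Re z); change (snd z) with (Im z).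
transitivity (Re z ^ 2 + (q1 I ^ 2 + q2 I ^ 2 + q3 I ^ 2) * Im z ^ 2); [ring|].
rewrite H1; ring.
Qed.

Lemma slice_inv (I : quat) (z : C) : imag_unit I -> z <> 0 ->
  qinv (slice I z) = slice I (/ z)%C.
Proof.
intros HI Hz; unfold qinv; rewrite qabs_slice by exact HI.
destruct (imag_unit_coords I HI) as [H0 _].
rewrite Cmod2_alt.
assert (N : Re z ^ 2 + Im z ^ 2 <> 0).
{ rewrite <- Cmod2_alt; apply pow_nonzero; intros E; now apply Hz, Cmod_eq_0. }
apply quat_eq; qcoords; unfold qconj;
  rewrite ?(proj1 (mkq_coords _ _ _ _)), ?(proj1 (proj2 (mkq_coords _ _ _ _))),
  ?(proj1 (proj2 (proj2 (mkq_coords _ _ _ _)))), ?(proj2 (proj2 (proj2 (mkq_coords _ _ _ _))));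
  qcoords; unfold Cinv; unfold Re, Im in *; cbn [fst snd]; rewrite ?H0; field; exact N.
Qed.

(** A non-real quaternion determines its slice up to sign; a real one lies on
    all of them, and [i] is taken. *)
Lemma slice_surj (q : quat) : exists I z, imag_unit I /\ q = slice I z.
Proof.
set (s := sqrt (q1 q ^ 2 + q2 q ^ 2 + q3 q ^ 2)).
assert (P : 0 <= q1 q ^ 2 + q2 q ^ 2 + q3 q ^ 2) by nra.
assert (Hs : s * s = q1 q ^ 2 + q2 q ^ 2 + q3 q ^ 2) by now apply sqrt_sqrt.
destruct (Req_dec s 0) as [E|N].
- rewrite E in Hs.
  exists (mkq 0 1 0 0), (q0 q, 0); split.
  + unfold imag_unit; apply quat_eq; qcoords; unfold mkq, q0, q1, q2, q3; simpl; lra.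
  + apply quat_eq; qcoords; unfold Re, Im; simpl fst; simpl snd;
      [change (q0 (mkq 0 1 0 0)) with 0; ring | nra | nra | nra].
- exists (mkq 0 (q1 q / s) (q2 q / s) (q3 q / s)), (q0 q, s).
  assert (Q0 : q0 (mkq 0 (q1 q / s) (q2 q / s) (q3 q / s)) = 0) by reflexivity.
  assert (Q1 : q1 (mkq 0 (q1 q / s) (q2 q / s) (q3 q / s)) = q1 q / s) by reflexivity.
  assert (Q2 : q2 (mkq 0 (q1 q / s) (q2 q / s) (q3 q / s)) = q2 q / s) by reflexivity.
  assert (Q3 : q3 (mkq 0 (q1 q / s) (q2 q / s) (q3 q / s)) = q3 q / s) by reflexivity.
  split.
  + unfold imag_unit; apply quat_eq; qcoords; rewrite Q0, Q1, Q2, Q3; try (field; exact N).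
    transitivity (- ((q1 q ^ 2 + q2 q ^ 2 + q3 q ^ 2) / (s * s))); [field; exact N|].
    rewrite <- Hs; field; exact N.
  + apply quat_eq; qcoords; rewrite ?Q0, ?Q1, ?Q2, ?Q3; unfold Re, Im; simpl fst; simpl snd;
      field; exact N.
Qed.

(** * Holomorphy on a slice *)

Lemma qabs_sq (q : quat) : qabs q ^ 2 = q0 q ^ 2 + q1 q ^ 2 + q2 q ^ 2 + q3 q ^ 2.
Proof.
unfold qabs; apply pow2_sqrt.
generalize (pow2_ge_0 (q0 q)) (pow2_ge_0 (q1 q)) (pow2_ge_0 (q2 q)) (pow2_ge_0 (q3 q)); lra.
Qed.

Lemma qabs_pos (q : quat) : 0 <= qabs q.
Proof. apply sqrt_pos. Qed.

Lemma qabs_mult (p q : quat) : qabs (mult p q) = qabs p * qabs q.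
Proof.
apply Rsqr_inj; try apply Rmult_le_pos; try apply qabs_pos.
rewrite !Rsqr_pow2, Rpow_mult_distr, !qabs_sq; qcoords; ring.
Qed.

Lemma Rabs_le_of_sq (x y : R) : 0 <= y -> x ^ 2 <= y ^ 2 -> Rabs x <= y.
Proof.
intros Hy H; rewrite <- (Rabs_pos_eq y Hy); apply Rsqr_le_abs_0.
now rewrite !Rsqr_pow2.
Qed.

Lemma coord_le_qabs (q : quat) : Rabs (q0 q) <= qabs q /\ Rabs (q1 q) <= qabs q /\
  Rabs (q2 q) <= qabs q /\ Rabs (q3 q) <= qabs q.
Proof.
repeat split; apply Rabs_le_of_sq; try apply qabs_pos; rewrite qabs_sq;
  generalize (pow2_ge_0 (q0 q)) (pow2_ge_0 (q1 q)) (pow2_ge_0 (q2 q)) (pow2_ge_0 (q3 q)); lra.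
Qed.

Lemma qabs_triangle (p q : quat) : qabs (plus p q) <= qabs p + qabs q.
Proof.
rewrite <- !qabs_norm; apply (@norm_triangle R_AbsRing quat_NormedModule).
Qed.

Lemma qabs_opp (q : quat) : qabs (opp q) = qabs q.
Proof. unfold qabs; f_equal; qcoords; ring. Qed.

(** Holomorphy on the slice of [I]: the real differential of [G] is left
    multiplication of a quaternion by the increment, hence linear over the
    slice acting on the left. *)
Definition slice_diff (I : quat) (G : C -> quat) (z : C) : Prop :=
  exists A : quat, forall eps, 0 < eps -> exists delta, 0 < delta /\
    forall w, Cmod (w - z) < delta ->
      qabs (minus (minus (G w) (G z)) (mult (slice I (w - z)%C) A)) <= eps * Cmod (w - z).

(** A left factor that intertwines the slices of [J] and [I] turns
    [J]-holomorphic functions into [I]-holomorphic ones. *)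
Lemma slice_diff_mult_l (c I J : quat) (G : C -> quat) (z : C) :
  (forall h, mult c (slice J h) = mult (slice I h) c) ->
  slice_diff J G z -> slice_diff I (fun w => mult c (G w)) z.
Proof.
intros Hc [A HA]; exists (mult c A); intros eps Heps.
assert (Hp := qabs_pos c).
destruct (HA (eps / (qabs c + 1))) as (d & Hd & H); [apply Rdiv_lt_0_compat; lra|].
exists d; split; [exact Hd|]; intros w Hw; specialize (H w Hw).
assert (E : minus (minus (mult c (G w)) (mult c (G z))) (mult (slice I (w - z)%C) (mult c A))
  = mult c (minus (minus (G w) (G z)) (mult (slice J (w - z)%C) A))).
{ rewrite mult_assoc, <- Hc, <- mult_assoc; apply quat_eq; qcoords; ring. }
apply (f_equal qabs) in E; rewrite qabs_mult in E.
eapply Rle_trans; [exact (Req_le _ _ E)|].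
apply Rle_trans with (qabs c * (eps / (qabs c + 1) * Cmod (w - z))).
{ now apply Rmult_le_compat_l. }
rewrite <- Rmult_assoc; apply Rmult_le_compat_r; [apply Cmod_ge_0|].
replace eps with ((qabs c + 1) * (eps / (qabs c + 1))) at 2 by (field; lra).
apply Rmult_le_compat_r; [left; apply Rdiv_lt_0_compat|]; lra.
Qed.

Lemma slice_diff_minus (I : quat) (F G : C -> quat) (z : C) :
  slice_diff I F z -> slice_diff I G z -> slice_diff I (fun w => minus (F w) (G w)) z.
Proof.
intros [A HA] [B HB]; exists (minus A B); intros eps Heps.
destruct (HA (eps / 2)) as (d1 & Hd1 & H1); [lra|].
destruct (HB (eps / 2)) as (d2 & Hd2 & H2); [lra|].
exists (Rmin d1 d2); split; [now apply Rmin_pos|]; intros w Hw.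
specialize (H1 w (Rlt_le_trans _ _ _ Hw (Rmin_l _ _))).
specialize (H2 w (Rlt_le_trans _ _ _ Hw (Rmin_r _ _))).
assert (E : minus (minus (minus (F w) (G w)) (minus (F z) (G z)))
    (mult (slice I (w - z)%C) (minus A B)) =
  plus (minus (minus (F w) (F z)) (mult (slice I (w - z)%C) A))
    (opp (minus (minus (G w) (G z)) (mult (slice I (w - z)%C) B))))
  by (apply quat_eq; qcoords; ring).
apply (f_equal qabs) in E; eapply Rle_trans; [exact (Req_le _ _ E)|].
eapply Rle_trans; [apply qabs_triangle|]; rewrite qabs_opp; lra.
Qed.

Lemma cdiff_of_eps (F : C -> C) (z D : C) :
  (forall eps, 0 < eps -> exists delta, 0 < delta /\
    forall w, Cmod (w - z) < delta ->
      Cmod (F w - F z - (w - z) * D) <= eps * Cmod (w - z)) -> cdiff F z.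
Proof.
intros H.
exists (fun w => if Ceq_dec w z then D else ((F w - F z) / (w - z))%C); split.
- intros eps Heps; destruct (H (eps / 2)) as (d & Hd & H'); [lra|].
  exists d; split; [exact Hd|]; intros w Hw; specialize (H' w Hw).
  destruct (Ceq_dec z z) as [_|N]; [|contradiction].
  destruct (Ceq_dec w z) as [->|N]; [rewrite Cmod_self_minus; exact Heps|].
  assert (N' := Cminus_eq_contra _ _ N); assert (P := proj1 (Cmod_gt_0 _) N').
  replace ((F w - F z) / (w - z) - D)%C with ((F w - F z - (w - z) * D) / (w - z))%C
    by (field; exact N').
  rewrite Cmod_div by exact N'; apply Rlt_div_l; [exact P|]; nra.
- exists 1; split; [lra|]; intros w _.
  destruct (Ceq_dec w z) as [->|N]; [ring|].
  field; now apply Cminus_eq_contra.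
Qed.

(** Bounded maps to [C] that are linear for the slice of [I] acting on the left
    of the quaternions; composition with them reduces quaternionic statements
    to complex ones. *)
Definition slice_linear (I : quat) (phi : quat -> C) : Prop :=
  (forall p q, phi (minus p q) = phi p - phi q)%C /\
  (forall h q, phi (mult (slice I h) q) = h * phi q)%C /\
  (forall q, Cmod (phi q) <= 2 * qabs q).

Lemma slice_linear_cdiff (I : quat) (phi : quat -> C) (G : C -> quat) (z : C) :
  slice_linear I phi -> slice_diff I G z -> cdiff (fun w => phi (G w)) z.
Proof.
intros (Hm & Hl & Hb) [A HA]; apply (cdiff_of_eps _ _ (phi A)); intros eps Heps.
destruct (HA (eps / 2)) as (d & Hd & H); [lra|].
exists d; split; [exact Hd|]; intros w Hw; specialize (H w Hw).
rewrite <- Hl, <- !Hm; eapply Rle_trans; [apply Hb|]; lra.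
Qed.

(** The complex-linear functional with real part [coord], in the usual way:
    a complex functional is determined by its real part [u] as
    [u(q) - i u(I q)]. *)
Definition slice_coord (I : quat) (coord : quat -> R) (q : quat) : C :=
  (coord q, - coord (mult I q)).

Lemma slice_coord_linear (I : quat) (coord : quat -> R) : imag_unit I ->
  (forall p q, coord (plus p q) = coord p + coord q) ->
  (forall k q, coord (scal k q) = k * coord q) ->
  (forall q, Rabs (coord q) <= qabs q) ->
  slice_linear I (slice_coord I coord).
Proof.
intros HI Hp Hs Hb.
destruct (imag_unit_coords I HI) as [I0 I1].
assert (Hab : qabs I = 1).
{ unfold qabs; rewrite I0, <- sqrt_1; f_equal; lra. }
assert (Hm : forall p q, coord (minus p q) = coord p - coord q).
{ intros p q; replace (minus p q) with (plus p (scal (-1) q))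
    by (apply quat_eq; qcoords; ring).
  rewrite Hp, Hs; ring. }
split; [|split].
- intros p q; unfold slice_coord.
  replace (mult I (minus p q)) with (minus (mult I p) (mult I q))
    by (apply quat_eq; qcoords; ring).
  rewrite !Hm; unfold Cminus, Cplus, Copp; simpl; f_equal; ring.
- intros h q; unfold slice_coord.
  assert (E : mult (slice I h) q = plus (scal (Re h) q) (scal (Im h) (mult I q)))
    by (apply quat_eq; qcoords; ring).
  assert (E' : mult I (mult (slice I h) q) = plus (scal (Re h) (mult I q)) (scal (- Im h) q)).
  { rewrite E; replace (scal (- Im h) q) with (scal (Im h) (mult (mult I I) q)).
    - apply quat_eq; qcoords; ring.
    - unfold imag_unit in HI; rewrite HI; apply quat_eq; qcoords; ring. }
  rewrite E', E, !Hp, !Hs; destruct h as [x y]; unfold Cmult, Re, Im; simpl; f_equal; ring.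
- intros q; eapply Rle_trans; [apply Cmod_le_sum|]; unfold slice_coord; simpl.
  rewrite Rabs_Ropp; generalize (Hb q) (Hb (mult I q)); rewrite qabs_mult, Hab; lra.
Qed.

Lemma Derive_of_eps (g : R -> R) (x d : R) :
  (forall eps, 0 < eps -> exists delta, 0 < delta /\
    forall s, Rabs (s - x) < delta -> Rabs (g s - g x - (s - x) * d) <= eps * Rabs (s - x)) ->
  Derive g x = d.
Proof.
intros H; apply is_derive_unique, is_derive_Reals; intros eps Heps.
destruct (H (eps / 2)) as (delta & Hd & H'); [lra|].
exists (mkposreal _ Hd); simpl; intros h Hh Hhd.
specialize (H' (x + h)); replace (x + h - x) with h in H' by ring.
specialize (H' Hhd); assert (P := Rabs_pos_lt h Hh).
replace ((g (x + h) - g x) / h - d) with ((g (x + h) - g x - h * d) / h) by (field; exact Hh).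
unfold Rdiv; rewrite Rabs_mult, Rabs_inv; apply Rlt_div_l; [exact P|]; nra.
Qed.

(** The Cullen equation says [l 1 + I * l I = 0] for the real differential [l]
    at the point; multiplied by [I] on the left it becomes [l I = I * l 1],
    so that [l (h + I k) = (h + I k) * l 1]. *)
Lemma regular_slice_diff (Omega : quat -> Prop) (f : quat -> quat) (I : quat) (z : C) :
  regular Omega f -> imag_unit I -> Omega (slice I z) ->
  slice_diff I (fun w => f (slice I w)) z.
Proof.
intros [Hdiff Hcul] HI HO.
destruct (Hdiff _ HO) as [l [Hl Hd]].
specialize (Hd (slice I z) (fun P HP => HP)).
destruct z as [x y].
assert (K : forall eps, 0 < eps -> exists delta, 0 < delta /\
  forall w, Cmod (w - (x, y)) < delta ->
    qabs (minus (minus (f (slice I w)) (f (slice I (x, y))))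
      (plus (scal (Re w - x) (l one)) (scal (Im w - y) (l I)))) <= eps * Cmod (w - (x, y))).
{ intros eps Heps; destruct (Hd (mkposreal eps Heps)) as [delta Hdelta].
  exists delta; split; [apply cond_pos|]; intros w Hw.
  assert (Hn : qabs (minus (slice I w) (slice I (x, y))) = Cmod (w - (x, y))).
  { rewrite <- qabs_slice with (I := I) by exact HI; now rewrite slice_minus. }
  assert (Hb : ball (slice I (x, y)) delta (slice I w)).
  { apply (@norm_compat1 R_AbsRing quat_NormedModule).
    change (norm (minus (slice I w) (slice I (x, y))) < delta).
    rewrite qabs_norm, Hn; exact Hw. }
  specialize (Hdelta _ Hb); rewrite !qabs_norm in Hdelta; simpl pos in Hdelta.
  assert (El : l (minus (slice I w) (slice I (x, y))) =
    plus (scal (Re w - x) (l one)) (scal (Im w - y) (l I))).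
  { rewrite <- !(linear_scal l Hl), <- (linear_plus l Hl); f_equal.
    apply quat_eq; qcoords; unfold Re, Im; simpl fst; simpl snd; ring. }
  rewrite <- El, <- Hn; exact Hdelta. }
assert (Ex : qDerive (fun s => f (slice_pt I s y)) x = l one).
{ assert (Kx : forall eps, 0 < eps -> exists delta, 0 < delta /\
    forall s, Rabs (s - x) < delta ->
      qabs (minus (minus (f (slice_pt I s y)) (f (slice_pt I x y))) (scal (s - x) (l one)))
        <= eps * Rabs (s - x)).
  { intros eps Heps; destruct (K eps Heps) as (delta & Hdp & H); exists delta; split; auto.
    intros s Hs; specialize (H (s, y)).
    assert (Em : Cmod ((s, y) - (x, y)) = Rabs (s - x)).
    { rewrite <- Cmod_R; f_equal; unfold Cminus, Cplus, Copp, RtoC; simpl; f_equal; ring. }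
    rewrite Em in H; refine (Rle_trans _ _ _ (Req_le _ _ _) (H Hs)); f_equal.
    unfold Re, Im; simpl fst; simpl snd; apply quat_eq; qcoords; unfold slice, Re, Im;
      simpl fst; simpl snd; ring. }
  apply quat_eq; apply Derive_of_eps; intros eps Heps; destruct (Kx eps Heps) as (delta & Hdp & H);
    exists delta; (split; [exact Hdp|]); intros s Hs;
    refine (Rle_trans _ _ _ _ (H s Hs));
    [ refine (Rle_trans _ _ _ _ (proj1 (coord_le_qabs _)))
    | refine (Rle_trans _ _ _ _ (proj1 (proj2 (coord_le_qabs _))))
    | refine (Rle_trans _ _ _ _ (proj1 (proj2 (proj2 (coord_le_qabs _)))))
    | refine (Rle_trans _ _ _ _ (proj2 (proj2 (proj2 (coord_le_qabs _))))) ];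
    qcoords; right; reflexivity. }
assert (Ey : qDerive (fun s => f (slice_pt I x s)) y = l I).
{ assert (Ky : forall eps, 0 < eps -> exists delta, 0 < delta /\
    forall s, Rabs (s - y) < delta ->
      qabs (minus (minus (f (slice_pt I x s)) (f (slice_pt I x y))) (scal (s - y) (l I)))
        <= eps * Rabs (s - y)).
  { intros eps Heps; destruct (K eps Heps) as (delta & Hdp & H); exists delta; split; auto.
    intros s Hs; specialize (H (x, s)).
    assert (Em : Cmod ((x, s) - (x, y)) = Rabs (s - y)).
    { rewrite <- (Rmult_1_l (Rabs (s - y))), <- Cmod_Ci, <- Cmod_R, <- Cmod_mult; f_equal.
      unfold Ci, Cminus, Cmult, Cplus, Copp, RtoC; simpl; f_equal; ring. }
    rewrite Em in H; refine (Rle_trans _ _ _ (Req_le _ _ _) (H Hs)); f_equal.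
    unfold Re, Im; simpl fst; simpl snd; apply quat_eq; qcoords; unfold slice, Re, Im;
      simpl fst; simpl snd; ring. }
  apply quat_eq; apply Derive_of_eps; intros eps Heps; destruct (Ky eps Heps) as (delta & Hdp & H);
    exists delta; (split; [exact Hdp|]); intros s Hs;
    refine (Rle_trans _ _ _ _ (H s Hs));
    [ refine (Rle_trans _ _ _ _ (proj1 (coord_le_qabs _)))
    | refine (Rle_trans _ _ _ _ (proj1 (proj2 (coord_le_qabs _))))
    | refine (Rle_trans _ _ _ _ (proj1 (proj2 (proj2 (coord_le_qabs _)))))
    | refine (Rle_trans _ _ _ _ (proj2 (proj2 (proj2 (coord_le_qabs _))))) ];
    qcoords; right; reflexivity. }
assert (ElI : l I = mult I (l one)).
{ assert (Hc := Hcul I HI x y HO); unfold cullen_op in Hc; rewrite Ex, Ey in Hc.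
  assert (Hs : plus (l one) (mult I (l I)) = zero).
  { apply quat_eq;
      [apply (f_equal q0) in Hc | apply (f_equal q1) in Hc |
       apply (f_equal q2) in Hc | apply (f_equal q3) in Hc]; revert Hc; qcoords; lra. }
  assert (E : mult (mult I I) (l I) = opp (l I)).
  { unfold imag_unit in HI; rewrite HI; apply quat_eq; qcoords; ring. }
  rewrite <- mult_assoc in E.
  assert (E' : mult I (plus (l one) (mult I (l I))) = plus (mult I (l one)) (opp (l I))).
  { rewrite <- E; apply quat_eq; qcoords; ring. }
  rewrite Hs in E'.
  apply quat_eq;
      [apply (f_equal q0) in E' | apply (f_equal q1) in E' |
       apply (f_equal q2) in E' | apply (f_equal q3) in E']; revert E'; qcoords; lra. }
exists (l one); intros eps Heps; destruct (K eps Heps) as (delta & Hdp & H).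
exists delta; split; [exact Hdp|]; intros w Hw.
refine (Rle_trans _ _ _ (Req_le _ _ _) (H w Hw)); f_equal.
rewrite ElI; unfold Cminus; apply quat_eq; qcoords; rewrite re_plus, im_plus, re_opp, im_opp;
  unfold Re, Im; simpl fst; simpl snd; ring.
Qed.

(** * The representation formula *)

(** [(1 - I J) / 2], which satisfies [c J = I c]; it turns values on the slice
    of [J] into values on the slice of [I]. *)
Definition intertwiner (I J : quat) : quat := scal (1 / 2) (minus one (mult I J)).

Lemma intertwiner_slice (I J : quat) (h : C) : imag_unit I -> imag_unit J ->
  mult (intertwiner I J) (slice J h) = mult (slice I h) (intertwiner I J).
Proof.
intros HI HJ.
(* both sides are (I + J) / 2 *)
assert (E : mult (intertwiner I J) J = mult I (intertwiner I J)).
{ transitivity (scal (1 / 2) (minus J (mult I (mult J J)))).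
  { unfold intertwiner; apply quat_eq; qcoords; ring. }
  transitivity (scal (1 / 2) (minus I (mult (mult I I) J))).
  { unfold imag_unit in *; rewrite HI, HJ; apply quat_eq; qcoords; ring. }
  unfold intertwiner; apply quat_eq; qcoords; ring. }
set (c := intertwiner I J) in *.
transitivity (plus (scal (Re h) c) (scal (Im h) (mult c J))).
{ apply quat_eq; qcoords; ring. }
rewrite E; apply quat_eq; qcoords; ring.
Qed.

Lemma intertwiner_sum (I J q : quat) :
  plus (mult (intertwiner I J) q) (mult (intertwiner I (opp J)) q) = q.
Proof.
unfold intertwiner; apply quat_eq; qcoords; field.
Qed.

(** The representation formula for the monomials, and the reason why a series
    on one slice extends to all slices with the same coefficients. *)
Lemma slice_term_split (I J a : quat) (h : C) : imag_unit I -> imag_unit J ->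
  mult (slice I h) a =
    plus (mult (intertwiner I J) (mult (slice J h) a))
         (mult (intertwiner I (opp J)) (mult (slice J (Cconj h)) a)).
Proof.
intros HI HJ.
transitivity (mult (slice I h)
  (plus (mult (intertwiner I J) a) (mult (intertwiner I (opp J)) a))).
{ f_equal; symmetry; apply intertwiner_sum. }
rewrite <- slice_opp, !mult_assoc.
rewrite !intertwiner_slice by auto using imag_unit_opp.
rewrite <- !mult_assoc; apply (@mult_distr_l quat_Ring).
Qed.

Lemma slice_real (I J : quat) (x : R) : slice I x = slice J x.
Proof. apply quat_eq; qcoords; unfold Re, Im, RtoC; simpl; ring. Qed.

(** Both sides are [I]-holomorphic functions of [z], the right-hand one thanks
    to the intertwiners, and they agree for real [z], where all slices meet
    and the intertwiners for [J] and [-J] add up to [1].  The identity theorem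
    applied to the functionals [slice_coord] of the difference gives equality
    on the whole annulus. *)
Lemma representation_formula (R1 R2 : R) (f : quat -> quat) (I J : quat) (z : C) :
  0 <= R1 -> regular (annulus R1 R2) f -> imag_unit I -> imag_unit J ->
  R1 < Cmod z < R2 ->
  f (slice I z) = plus (mult (intertwiner I J) (f (slice J z)))
                       (mult (intertwiner I (opp J)) (f (slice J (Cconj z)))).
Proof.
intros HR1 Hf HI HJ Hz.
assert (HJ' := imag_unit_opp J HJ).
pose (G := fun w => minus (minus (f (slice I w)) (mult (intertwiner I J) (f (slice J w))))
                          (mult (intertwiner I (opp J)) (f (slice (opp J) w)))).
assert (Hsd : forall K w, imag_unit K -> R1 < Cmod w < R2 ->
  slice_diff K (fun w => f (slice K w)) w).
{ intros K w HK Hw; apply (regular_slice_diff _ _ _ _ Hf HK).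
  unfold annulus; now rewrite qabs_slice. }
assert (HG : forall w, R1 < Cmod w < R2 -> slice_diff I G w).
{ intros w Hw; unfold G.
  apply (slice_diff_minus I (fun w => minus (f (slice I w)) (mult (intertwiner I J) (f (slice J w))))
    (fun w => mult (intertwiner I (opp J)) (f (slice (opp J) w)))).
  - apply (slice_diff_minus I (fun w => f (slice I w))
      (fun w => mult (intertwiner I J) (f (slice J w)))); [now apply Hsd|].
    apply (slice_diff_mult_l _ I J (fun w => f (slice J w))); [|now apply Hsd].
    intros h; now apply intertwiner_slice.
  - apply (slice_diff_mult_l _ I (opp J) (fun w => f (slice (opp J) w))); [|now apply Hsd].
    intros h; now apply intertwiner_slice. }
assert (HG0 : forall x : R, G x = zero).
{ intros x; unfold G; rewrite (slice_real I J), (slice_real (opp J) J).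
  generalize (intertwiner_sum I J (f (slice J x))).
  generalize (mult (intertwiner I J) (f (slice J x)))
    (mult (intertwiner I (opp J)) (f (slice J x))).
  intros u v <-; apply quat_eq; qcoords; ring. }
assert (Hcoord : forall coord : quat -> R,
  (forall p q, coord (plus p q) = coord p + coord q) ->
  (forall k q, coord (scal k q) = k * coord q) ->
  (forall q, Rabs (coord q) <= qabs q) -> coord (G z) = 0).
{ intros coord Hp Hs Hb.
  assert (E : slice_coord I coord (G z) = 0).
  { apply (identity_annulus (fun w => slice_coord I coord (G w)) R1 R2); auto.
    - intros w Hw; apply (slice_linear_cdiff I); [|now apply HG].
      now apply slice_coord_linear.
    - intros x Hx; rewrite HG0; unfold slice_coord.
      assert (Z : forall q, qabs q = 0 -> coord q = 0).
      { intros q Hq; generalize (Hb q); rewrite Hq; intros Z.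
        apply Rabs_le_between in Z; lra. }
      assert (Z0 : qabs zero = 0).
      { unfold qabs; rewrite <- sqrt_0; f_equal; qcoords; ring. }
      apply injective_projections; simpl.
      + now apply Z.
      + apply Ropp_eq_0_compat, Z; rewrite qabs_mult.
        apply Rmult_eq_0_compat_l, Z0. }
  exact (f_equal fst E). }
assert (HGz : G z = zero).
{ apply quat_eq; apply Hcoord; try (intros; qcoords; reflexivity);
    intros q; apply coord_le_qabs. }
rewrite <- slice_opp; unfold G in HGz.
apply quat_eq;
      [apply (f_equal q0) in HGz | apply (f_equal q1) in HGz |
       apply (f_equal q2) in HGz | apply (f_equal q3) in HGz]; revert HGz; qcoords; lra.
Qed.

(** * The Laurent expansion of a regular function *)

Definition unit_i : quat := mkq 0 1 0 0.

(** The quaternions split as [C + C j] over the slice of [i]; left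
    multiplication by this slice acts on both summands separately. *)
Definition join (u v : C) : quat := mkq (Re u) (Im u) (Re v) (Im v).
Definition first_part (q : quat) : C := (q0 q, q1 q).
Definition second_part (q : quat) : C := (q2 q, q3 q).

Lemma imag_unit_i : imag_unit unit_i.
Proof. unfold imag_unit; apply quat_eq; qcoords; unfold unit_i, mkq, q0, q1, q2, q3; simpl; ring. Qed.

Lemma parts_linear :
  slice_linear unit_i first_part /\ slice_linear unit_i second_part.
Proof.
assert (B : forall a b q, Rabs a <= qabs q -> Rabs b <= qabs q -> Cmod (a, b) <= 2 * qabs q).
{ intros a b q Ha Hb; eapply Rle_trans; [apply Cmod_le_sum|]; simpl; lra. }
split; (split; [|split]); try (intros p q; reflexivity);
  try (intros q; apply B; apply coord_le_qabs).
- intros h q; unfold first_part; qcoords; unfold unit_i.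
  unfold q0, q1, q2, q3, mkq, Cmult, Re, Im; simpl; f_equal; ring.
- intros h q; unfold second_part; qcoords; unfold unit_i.
  unfold q0, q1, q2, q3, mkq, Cmult, Re, Im; simpl; f_equal; ring.
Qed.

Lemma join_mult (z u v : C) : join (z * u) (z * v) = mult (slice unit_i z) (join u v).
Proof.
apply quat_eq; qcoords; unfold join, unit_i.
all: unfold q0, q1, q2, q3, mkq, Cmult, Re, Im; simpl; ring.
Qed.

Lemma is_series_join (u v : nat -> C) (l m : C) : is_Cseries u l -> is_Cseries v m ->
  @is_series R_AbsRing quat_NormedModule (fun n => join (u n) (v n)) (join l m).
Proof.
intros Hu Hv; apply is_Cseries_Re_Im in Hu, Hv; destruct Hu as [H0 H1], Hv as [H2 H3].
apply filterlim_ext with (fun n =>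
  mkq (sum_n (fun k => Re (u k)) n) (sum_n (fun k => Im (u k)) n)
      (sum_n (fun k => Re (v k)) n) (sum_n (fun k => Im (v k)) n)).
{ induction x as [|n IH]; [now rewrite !sum_O|].
  rewrite !sum_Sn, <- IH; reflexivity. }
apply filterlim_locally; intros eps.
generalize (filter_and _ _ (filter_and _ _ (filter_and _ _
  (proj1 (filterlim_locally _ _) H0 eps) (proj1 (filterlim_locally _ _) H1 eps))
  (proj1 (filterlim_locally _ _) H2 eps)) (proj1 (filterlim_locally _ _) H3 eps)).
apply filter_imp; intros n H; exact H.
Qed.

Lemma is_series_qmult_l (c : quat) (a : nat -> quat) (l : quat) :
  @is_series R_AbsRing quat_NormedModule a l ->
  @is_series R_AbsRing quat_NormedModule (fun n => mult c (a n)) (mult c l).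
Proof.
intros Ha.
assert (Hlin : @is_linear R_AbsRing quat_NormedModule quat_NormedModule (fun q => mult c q)).
{ split.
  - intros p q; apply (@mult_distr_l quat_Ring).
  - intros k q; apply quat_eq; qcoords; ring.
  - exists (qabs c + 1); split; [generalize (qabs_pos c); lra|]; intros q.
    rewrite !qabs_norm, qabs_mult; generalize (qabs_pos q); nra. }
apply filterlim_ext with (fun n => mult c (@sum_n quat_AbelianGroup a n)).
{ induction x as [|n IH]; [now rewrite !sum_O|].
  rewrite !sum_Sn, <- IH; apply (@mult_distr_l quat_Ring). }
eapply filterlim_comp; [exact Ha|].
apply (linear_cont _ _ Hlin).
Qed.

Definition laurent_coef (F1 F2 : C -> C) (r : R) (n : Z) : quat :=
  match n with
  | Zneg p => join (laurent_neg F1 r (Pos.to_nat p)) (laurent_neg F2 r (Pos.to_nat p))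
  | _ => join (laurent_pos F1 r (Z.to_nat n)) (laurent_pos F2 r (Z.to_nat n))
  end.

Lemma qpowz_nat (q : quat) (n : nat) : qpowz q (Z.of_nat n) = pow_n q n.
Proof.
destruct n as [|n]; [reflexivity|]; simpl Z.of_nat; unfold qpowz.
now rewrite SuccNat2Pos.id_succ.
Qed.

Lemma qpowz_opp_nat (q : quat) (n : nat) : qpowz q (- Z.of_nat (S n)) = pow_n (qinv q) (S n).
Proof. simpl Z.of_nat; simpl Z.opp; unfold qpowz; now rewrite SuccNat2Pos.id_succ. Qed.

(** The complex expansion applied to the two summands of [f] over the slice of
    [i]. *)
Lemma slice_i_laurent (R1 R2 r : R) (f : quat -> quat) :
  0 <= R1 -> R1 < r < R2 -> regular (annulus R1 R2) f ->
  let F1 := fun z => first_part (f (slice unit_i z)) in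
  let F2 := fun z => second_part (f (slice unit_i z)) in
  forall z, R1 < Cmod z < R2 -> exists l1 l2,
    f (slice unit_i z) = plus l1 l2 /\
    @is_series R_AbsRing quat_NormedModule (fun n =>
      mult (slice unit_i (z ^ n)%C) (laurent_coef F1 F2 r (Z.of_nat n))) l1 /\
    @is_series R_AbsRing quat_NormedModule (fun n =>
      mult (slice unit_i ((/ z) ^ S n)%C) (laurent_coef F1 F2 r (- Z.of_nat (S n)))) l2.
Proof.
intros HR1 Hr Hf F1 F2 z Hz.
assert (Hd : forall w, R1 < Cmod w < R2 -> slice_diff unit_i (fun w => f (slice unit_i w)) w).
{ intros w Hw; apply (regular_slice_diff _ _ _ _ Hf imag_unit_i).
  unfold annulus; rewrite qabs_slice by exact imag_unit_i; exact Hw. }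
destruct (complex_laurent F1 R1 R2 r HR1 Hr) with (w := z) as (l1 & l2 & E & HP & HN);
  [|exact Hz|].
{ intros w Hw; apply (slice_linear_cdiff unit_i); [apply parts_linear | now apply Hd]. }
destruct (complex_laurent F2 R1 R2 r HR1 Hr) with (w := z) as (m1 & m2 & E' & HP' & HN');
  [|exact Hz|].
{ intros w Hw; apply (slice_linear_cdiff unit_i); [apply parts_linear | now apply Hd]. }
exists (join l1 m1), (join l2 m2); split; [|split].
- apply quat_eq; qcoords;
    [apply (f_equal Re E) | apply (f_equal Im E) | apply (f_equal Re E') | apply (f_equal Im E')].
- eapply is_series_ext; [|exact (is_series_join _ _ _ _ HP HP')].
  intros n; cbv beta; rewrite join_mult; f_equal.
  unfold laurent_coef; destruct n; [reflexivity|]; simpl Z.of_nat; cbv iota.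
  simpl Z.to_nat; now rewrite SuccNat2Pos.id_succ.
- eapply is_series_ext; [|exact (is_series_join _ _ _ _ HN HN')].
  intros n; cbv beta; rewrite join_mult; f_equal.
  unfold laurent_coef; simpl Z.of_nat; simpl Z.opp; cbv iota.
  now rewrite SuccNat2Pos.id_succ.
Qed.

Theorem theorem3p4 (R1 R2 : R) (f : quat -> quat)
  (hR1 : 0 <= R1) (hR2 : R1 < R2) (hf : regular (annulus R1 R2) f) :
  exists a : Z -> quat,
    forall q : quat, annulus R1 R2 q ->
      is_Zseries (fun n : Z => mult (qpowz q n) (a n)) (f q).
Proof.
set (r := (R1 + R2) / 2); assert (Hr : R1 < r < R2) by (unfold r; lra).
pose (a := laurent_coef (fun z => first_part (f (slice unit_i z)))
  (fun z => second_part (f (slice unit_i z))) r).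
exists a; intros q Hq.
destruct (slice_surj q) as (I & z & HI & ->).
assert (Hz : R1 < Cmod z < R2) by (unfold annulus in Hq; now rewrite qabs_slice in Hq).
assert (Hzc : R1 < Cmod (Cconj z) < R2) by now rewrite Cmod_conj.
assert (nz : z <> 0) by (apply Cmod_pos_neq0; lra).
destruct (slice_i_laurent R1 R2 r f hR1 Hr hf z Hz) as (l1 & l2 & E & HP & HN).
destruct (slice_i_laurent R1 R2 r f hR1 Hr hf (Cconj z) Hzc) as (m1 & m2 & E' & HP' & HN').
set (c := intertwiner I unit_i); set (c' := intertwiner I (opp unit_i)).
exists (plus (mult c l1) (mult c' m1)), (plus (mult c l2) (mult c' m2)).
split; [|split].
- refine (is_series_ext _ _ _ _ (is_series_plus _ _ _ _
    (is_series_qmult_l c _ _ HP) (is_series_qmult_l c' _ _ HP'))).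
  intros n; rewrite qpowz_nat, <- slice_pow by exact HI.
  rewrite (slice_term_split I unit_i _ _ HI imag_unit_i), Cpow_conj; reflexivity.
- refine (is_series_ext _ _ _ _ (is_series_plus _ _ _ _
    (is_series_qmult_l c _ _ HN) (is_series_qmult_l c' _ _ HN'))).
  intros n; rewrite qpowz_opp_nat, slice_inv, <- slice_pow by assumption.
  rewrite (slice_term_split I unit_i _ _ HI imag_unit_i), Cpow_conj, Cinv_conj by exact nz.
  reflexivity.
- rewrite (representation_formula R1 R2 f I unit_i z hR1 hf HI imag_unit_i Hz), E, E'.
  assert (Hdist : forall d p q : quat, mult d (plus p q) = plus (mult d p) (mult d q))
    by (intros; apply (@mult_distr_l quat_Ring)).
  fold c c'; rewrite !Hdist.
  generalize (mult c l1) (mult c l2) (mult c' m1) (mult c' m2).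
  intros; apply quat_eq; qcoords; ring.
Qed.
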